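(* Assume (A1) and (C1). Then $$\sup_{x\in[0,1]^d}|g_n(x)-Eg_n(x)|=O_{a.s.}\!\left[\frac{(\log n)^{1/2}}{(nh_n)^{d/2}}\right].$$
   Context: Fix an integer $d\ge1$. For $x=(x_1,\dots,x_d)\in\mathbb{R}^d$ let $\|x\|=\max_{1\le k\le d}|x_k|$; for $i,j\in\mathbb{Z}^d$ let $|i-j|=\max_{1\le l\le d}|i_l-j_l|$, and $|k|=|k-0|$. Let $(\varepsilon_i)_{i\in\mathbb{Z}^d}$ be a strictly stationary real random field on a probability space $(\Omega,\mathcal F,\mathbb P)$ with $E\varepsilon_0=0$. Strict stationarity means: for all $k\in\mathbb{Z}^d$, $n\ge1$ and $i_1,\dots,i_n\in\mathbb{Z}^d$, the vectors $(\varepsilon_{i_1},\dots,\varepsilon_{i_n})$ and $(\varepsilon_{i_1+k},\dots,\varepsilon_{i_n+k})$ have the same law. Let $g:[0,1]^d\to\mathbb{R}$ and $\Lambda_n=\{1,\dots,n\}^d$, and set $Y_i=g(i/n)+\varepsilon_i$ for $i\in\Lambda_n$. Let $K$ be a probability density on $\mathbb{R}^d$ and $(h_n)_{n\ge1}$ positive numbers with $h_n\to0$ and $nh_n\to\infty$. For $x\in[0,1]^d$ define $$g_n(x)=\frac{\sum_{i\in\Lambda_n}Y_i\,K\big((x-i/n)/h_n\big)}{\sum_{i\in\Lambda_n}K\big((x-i/n)/h_n\big)}.$$ Assumption (A1): $K$ is symmetric and nonnegative, and supported in $[-1,1]^d$. There is $\eta>0$ with $|K(x)-K(y)|\le\eta\|x-y\|$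 for all $x,y\in[-1,1]^d$, and there are constants $c,C>0$ with $c\le K(x)\le C$ for all $x\in[-1,1]^d$. Notation $O_{a.s.}$: for real random variables $Z_n$ and positive numbers $v_n$, $Z_n=O_{a.s.}[v_n]$ means there exists a deterministic $\lambda>0$ with $\limsup_{n\to\infty}|Z_n|/v_n\le\lambda$ almost surely. Dependence notation: $i<_{lex}j$ for distinct $i,j\in\mathbb{Z}^d$ means either $i_1<j_1$, or for some $p\in\{2,\dots,d\}$ one has $i_p<j_p$ and $i_q=j_q$ for $1\le q<p$. Set $V_i^1=\{j\in\mathbb{Z}^d: j<_{lex}i\}$ and, for integers $m\ge2$, $V_i^m=V_i^1\cap\{j:|i-j|\ge m\}$. For $\Gamma\subset\mathbb{Z}^d$ let $\mathcal F_\Gamma=\sigma(\varepsilon_j: j\in\Gamma)$. For $k\in V_0^1$ (so $|k|\ge1$) put $E_{|k|}(\varepsilon_0)=E(\varepsilon_0\mid\mathcal F_{V_0^{|k|}})$. Condition (C1): $\varepsilon_0\in L^\infty$ and $\sum_{k\in V_0^1}\|\varepsilon_kE_{|k|}(\varepsilon_0)\|_\infty<\infty$. *)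

(* Defs.v *)
From HB Require Import structures.
From mathcomp Require Import all_boot all_order all_algebra.
From mathcomp Require Import all_classical all_reals all_analysis ess_sup_inf.
Set Implicit Arguments. Unset Strict Implicit. Unset Printing Implicit Defensive.
Import Order.TTheory GRing.Theory Num.Theory.
Import numFieldNormedType.Exports.
Local Open Scope classical_set_scope.
Local Open Scope ring_scope.

Notation Zd d := (d.-tuple int).
Notation Rd R d := (d.-tuple R).

Definition zdist (d : nat) (i j : Zd d) : nat :=
  \max_(l < d) `|tnth i l - tnth j l|%N.

Definition rnorm (R : realType) (d : nat) (x : Rd R d) : R :=
  \big[Num.max/0]_(l < d) `|tnth x l|.

Definition zadd (d : nat) (i k : Zd d) : Zd d := [tuple tnth i l + tnth k l | l < d].
Definition zzero (d : nat) : Zd d := [tuple 0 | l < d].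

Definition lex_lt (d : nat) (i j : Zd d) : Prop :=
  i <> j /\ exists p : 'I_d, tnth i p < tnth j p /\
                          forall q : 'I_d, (q < p)%N -> tnth i q = tnth j q.

(* V_i^m (for m = 1 the extra condition |i-j| >= 1 is automatic) *)
Definition Vset (d : nat) (i : Zd d) (m : nat) : set (Zd d) :=
  [set j | lex_lt j i /\ (m <= zdist i j)%N].

Definition sigma_field_of {dT} {T : measurableType dT} {R : realType} {d : nat}
  (eps : Zd d -> T -> R) (Gam : set (Zd d)) : set (set T) :=
  <<s [set A | exists j, Gam j /\ exists B : set R, measurable B /\ A = eps j @^-1` B] >>.

Definition is_cond_exp {dT} {T : measurableType dT} {R : realType}
  (P : probability T R) (G : set (set T)) (X Y : T -> R) : Prop :=
  (forall B : set R, measurable B -> G (Y @^-1` B)) /\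
  P.-integrable setT (EFin \o Y) /\
  forall A, G A -> (\int[P]_(w in A) (Y w)%:E = \int[P]_(w in A) (X w)%:E)%E.

Definition Linfty_norm {dT} {T : measurableType dT} {R : realType}
  (P : probability T R) (f : T -> R) : \bar R :=
  ess_sup P (fun w => (`|f w|)%:E).

Definition strictly_stationary {dT} {T : measurableType dT} {R : realType} {d : nat}
  (P : probability T R) (eps : Zd d -> T -> R) : Prop :=
  forall (k : Zd d) (n : nat) (s : n.-tuple (Zd d)) (B : set (n.-tuple R)),
    measurable B ->
    P [set w | B [tuple eps (tnth s m) w | m < n]] =
    P [set w | B [tuple eps (zadd (tnth s m) k) w | m < n]].

(* iterated Lebesgue integral over R^d (nonnegative integrands) *)
Fixpoint iter_int (R : realType) (d : nat) : (Rd R d -> R) -> \bar R :=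
  match d with
  | 0 => fun f => (f [tuple])%:E
  | d'.+1 => fun f => (\int[@lebesgue_measure R]_(t in [set: R])
                         iter_int (fun x : Rd R d' => f [tuple of t :: x]))%E
  end.

Definition A1 (R : realType) (d : nat) (K : Rd R d -> R) : Prop :=
  (forall x, 0 <= K x) /\ iter_int K = 1%E /\
  (forall x, K [tuple - tnth x l | l < d] = K x) /\
  (forall x, 1 < rnorm x -> K x = 0) /\
  (exists eta : R, 0 < eta /\ forall x y, rnorm x <= 1 -> rnorm y <= 1 ->
      `|K x - K y| <= eta * rnorm [tuple tnth x l - tnth y l | l < d]) /\
  (exists c C : R, 0 < c /\ 0 < C /\ forall x, rnorm x <= 1 -> c <= K x <= C).

Definition C1 {dT} {T : measurableType dT} {R : realType} {d : nat}
  (P : probability T R) (eps : Zd d -> T -> R) : Prop :=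
  (Linfty_norm P (eps (zzero d)) < +oo)%E /\
  exists Y : Zd d -> T -> R,
    (forall k, Vset (zzero d) 1 k ->
       is_cond_exp P (sigma_field_of eps (Vset (zzero d) (zdist k (zzero d))))
                   (eps (zzero d)) (Y k)) /\
    (\esum_(k in Vset (zzero d) 1) Linfty_norm P (fun w => (eps k w * Y k w)%R) < +oo)%E.

Definition scale_idx (R : realType) (d n : nat) (i : Zd d) : Rd R d :=
  [tuple (tnth i l)%:~R / n%:R | l < d].

(* Lambda_n = {1..n}^d, enumerated by j : d.-tuple 'I_n via i_l = j_l + 1 *)
Definition lam_idx (d n : nat) (j : d.-tuple 'I_n) : Zd d :=
  [tuple (nat_of_ord (tnth j l))%:Z + 1 | l < d].

Definition kweight (R : realType) (d n : nat) (K : Rd R d -> R) (h : nat -> R)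
  (x : Rd R d) (i : Zd d) : R :=
  K [tuple (tnth x l - tnth (scale_idx R n i) l) / h n | l < d].

Definition g_est {dT} {T : measurableType dT} {R : realType} {d : nat}
  (g : Rd R d -> R) (eps : Zd d -> T -> R) (K : Rd R d -> R) (h : nat -> R)
  (n : nat) (x : Rd R d) : T -> R :=
  fun w =>
    (\sum_(j : d.-tuple 'I_n)
        (g (scale_idx R n (lam_idx j)) + eps (lam_idx j) w) * kweight n K h x (lam_idx j))
    / (\sum_(j : d.-tuple 'I_n) kweight n K h x (lam_idx j)).

Definition unit_cube (R : realType) (d : nat) : set (Rd R d) :=
  [set x | forall l, 0 <= tnth x l <= 1].

(* Main.v *)
Require Import Defs.
From HB Require Import structures.
From mathcomp Require Import all_boot all_order all_algebra.
From mathcomp Require Import all_classical all_reals all_analysis ess_sup_inf measurable_realfun.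
From mathcomp Require Import ring lra zify.
Set Implicit Arguments.
Unset Strict Implicit.
Unset Printing Implicit Defensive.
Import Order.TTheory GRing.Theory Num.Theory.
Import numFieldNormedType.Exports.
Local Open Scope classical_set_scope.
Local Open Scope ring_scope.

(* Only the noise matters: [g_n(x) - E g_n(x)] is the kernel-weighted average of the field, and its
   denominator is at least [c N], where [N >= (n h / 2)^d] is the number of active sites.

   A sum [S] of [N] field values with weights of size at most [t] has [E exp(S) <= exp(V t^2 N)].
   By induction on [N]: remove the lexicographically largest site [i]; then the second-order Taylor
   term costs a factor [1 + O(t^2)], and the first-order term [E(eps_i exp(S'))] is telescoped along
   the remaining sites [k] taken by decreasing distance to [i], so that every increment is measurable
   with respect to the sigma-field conditioning [eps_i] and costs [t ||eps_k E_{|k|}(eps_0)||_oo]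
   times the exponential moment of a smaller set (after moving [i] to the origin by stationarity).
   (C1) sums these costs.

   A Chernoff bound with [t = sqrt(log n / N)] makes each deviation polynomially small, with an
   exponent at our disposal.  Since [K] jumps at the boundary of its support, [0,1]^d is divided into
   cells on which the set of active sites is constant and [x] varies by at most [n^-(d+1)]; there
   are polynomially many, the kernel is Lipschitz within a cell, and Borel-Cantelli concludes. *)


(** * Bounded random variables and integration against a sub-sigma-field *)

Section BoundedMeasurable.
Context {dT : measure_display} {T : measurableType dT} {R : realType}.
Context (P : probability T R).

(** The bound holds everywhere, not just almost surely, so the class is closed under sums, products
    and exponentials and consists of integrable variables. *)
Definition bounded_mfun (f : T -> R) : Prop :=
  measurable_fun setT f /\ exists M, forall w, `|f w| <= M.

Lemma bounded_mfun_integrable f : bounded_mfun f -> P.-integrable setT (EFin \o f).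
Proof.
move=> [mf [M fM]]; apply: measurable_bounded_integrable => //.
  by rewrite (le_lt_trans (@probability_le1 _ _ _ P setT _)) ?ltry.
exists M; split; first exact: num_real.
by move=> y My w _; apply: le_trans (fM w) (ltW My).
Qed.

Lemma bounded_mfun_cst c : bounded_mfun (fun _ => c).
Proof. by split; [exact: measurable_cst | exists `|c|]. Qed.

Lemma bounded_mfunD f g : bounded_mfun f -> bounded_mfun g ->
  bounded_mfun (fun w => f w + g w).
Proof.
move=> [mf [M fM]] [mg [N gN]]; split; first exact: measurable_funD.
by exists (M + N) => w; rewrite (le_trans (ler_normD _ _))// lerD.
Qed.

Lemma bounded_mfunM f g : bounded_mfun f -> bounded_mfun g ->
  bounded_mfun (fun w => f w * g w).
Proof.
move=> [mf [M fM]] [mg [N gN]]; split; first exact: measurable_funM.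
by exists (M * N) => w; rewrite normrM ler_pM.
Qed.

Lemma bounded_mfunB f g : bounded_mfun f -> bounded_mfun g ->
  bounded_mfun (fun w => f w - g w).
Proof.
move=> [mf [M fM]] [mg [N gN]]; split; first exact: measurable_funB.
by exists (M + N) => w; rewrite (le_trans (ler_normB _ _))// lerD.
Qed.

Lemma bounded_mfun_expR f : bounded_mfun f -> bounded_mfun (fun w => expR (f w)).
Proof.
move=> [mf [M fM]]; split; first exact: measurableT_comp.
exists (expR M) => w; rewrite ger0_norm ?expR_ge0// ler_expR.
exact: le_trans (ler_norm _) (fM w).
Qed.

Lemma bounded_mfun_sum (I : Type) (s : seq I) (F : I -> T -> R) :
  (forall i, bounded_mfun (F i)) -> bounded_mfun (fun w => \sum_(i <- s) F i w).
Proof.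
move=> FB; elim: s => [|i s IH].
  by under eq_fun do rewrite big_nil; exact: bounded_mfun_cst.
by under eq_fun do rewrite big_cons; exact: bounded_mfunD.
Qed.

Lemma integrableM_bounded (D Z : T -> R) : P.-integrable setT (EFin \o D) ->
  bounded_mfun Z -> P.-integrable setT (EFin \o (fun w => D w * Z w)).
Proof.
move=> iD [mZ [M ZM]].
rewrite (_ : EFin \o _ = (EFin \o D) \* (EFin \o Z))%E; last first.
  by apply/funext => w /=; rewrite EFinM.
apply: integrableMl => //.
exists M; split; first exact: num_real.
by move=> y My w _; apply: le_trans (ZM w) (ltW My).
Qed.

Lemma Rintegral_sum (I : Type) (s : seq I) (F : I -> T -> R) :
  (forall i, P.-integrable setT (EFin \o F i)) ->
  \int[P]_w (\sum_(i <- s) F i w) = \sum_(i <- s) \int[P]_w F i w.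
Proof.
move=> FB; elim: s => [|i s IH].
  by under eq_Rintegral do rewrite big_nil; rewrite big_nil Rintegral_cst// mul0r.
under eq_Rintegral do rewrite big_cons.
rewrite big_cons RintegralD//; first by rewrite IH.
elim: s {IH} => [|j s IH].
  rewrite (_ : EFin \o _ = EFin \o cst 0); first exact: finite_measure_integrable_cst.
  by apply/funext => w /=; rewrite big_nil.
rewrite (_ : EFin \o _ = (EFin \o F j) \+ (EFin \o (fun w => (\sum_(i <- s) F i w)%R)))%E.
  exact: integrableD.
by apply/funext => w /=; rewrite big_cons.
Qed.

(** The sum counts the positive integers up to [y], so it is the integer part of [y]. *)
Lemma sum_threshold_approx (y : R) (K : nat) : 0 <= y <= K%:R ->
  y - 1 <= \sum_(k < K) ((k.+1%:R <= y)%R : nat)%:R <= y.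
Proof.
elim: K => [|K IH] /andP[y0 yK].
  by rewrite big_ord0 y0 andbT; lra.
rewrite big_ord_recr /=; have [yK'|Ky] := leP y K%:R.
  rewrite (_ : (K.+1%:R <= y) = false) ?addr0; first by apply: IH; rewrite y0.
  by apply/negbTE; rewrite -ltNge (le_lt_trans yK')// ltr_nat.
rewrite (eq_bigr (fun _ => 1)); last first.
  by move=> k _; rewrite (le_trans _ (ltW Ky))// ler_nat.
rewrite sumr_const card_ord -natr1.
rewrite -natr1 in yK; case: (leP (K%:R + 1) y) => ? /=; apply/andP; split; lra.
Qed.

(* [Z] is approximated within [r] by a staircase [r * S] over its superlevel sets. *)
Lemma Rintegral_mul_measurable0 (Gen : set (set T)) (D Z : T -> R) :
  <<s Gen >> `<=` measurable ->
  P.-integrable setT (EFin \o D) ->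
  (forall A, <<s Gen >> A -> \int[P]_(w in A) D w = 0) ->
  measurable_fun setT (Z : g_sigma_algebraType Gen -> R) ->
  bounded_mfun Z ->
  \int[P]_w (D w * Z w) = 0.
Proof.
move=> Gm iD D0 mZ ZB.
(* Adding the constant [M] makes [Z] nonnegative and changes the integral by [M] times the integral
   of [D], which is zero. *)
wlog Z0 : Z mZ ZB / forall w, 0 <= Z w.
  move=> H; have [_ [M ZM]] := ZB.
  have := H (fun w => Z w + M) _ _ _.
  under eq_Rintegral do rewrite mulrDr.
  rewrite RintegralD//; last 2 first.
  - exact: integrableM_bounded.
  - exact/integrableM_bounded/bounded_mfun_cst.
  rewrite RintegralZr// D0 ?mul0r ?addr0; last exact: (@measurableT _ (g_sigma_algebraType Gen)).
  apply.
  - by apply: measurable_funD => //; exact: measurable_cst.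
  - exact/bounded_mfunD/bounded_mfun_cst.
  - by move=> w; move: (ZM w); rewrite ler_norml; lra.
have [_ [M ZM]] := ZB.
apply/eqP; rewrite -normr_eq0 eq_le normr_ge0 andbT.
apply/ler_addgt0Pr => e e0; rewrite add0r.
set I := \int[P]_w `|D w|.
have I0 : 0 <= I by exact: Rintegral_ge0.
(* The staircase has steps of height [r]: the final error is at most [r * I], hence at most [e]. The
   [1] keeps the denominator positive. *)
pose r := e / (I + 1); have r0 : 0 < r by rewrite divr_gt0// ltr_wpDl.
pose K := Num.Def.archi_bound (M / r).
have ZK w : 0 <= Z w / r <= K%:R.
  rewrite divr_ge0 ?Z0 ?(ltW r0)//=; apply: ltW; apply: le_lt_trans (_ : M / r < _).
    by rewrite ler_pM2r ?invr_gt0// (le_trans (ler_norm _)).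
  apply: archi_boundP; rewrite divr_ge0 ?(ltW r0)//.
  exact: le_trans (normr_ge0 _) (ZM w).
pose A k := [set w | k.+1%:R <= Z w / r].
have mA k : <<s Gen >> (A k).
  have := mZ measurableT `[k.+1%:R * r, +oo[%classic (measurable_itv _).
  rewrite setTI; congr (<<s Gen >> _).
  apply/seteqP; split => w; rewrite /A /= in_itv/= andbT ler_pdivlMr//.
pose F k w : R := \1_(A k) w.
have FB k : bounded_mfun (F k).
  split; first exact/measurable_indic/Gm.
  by exists 1 => w; rewrite /F indicE; case: (_ \in _); rewrite ?normr1 ?normr0.
pose S w := \sum_(k < K) F k w.
have SB : bounded_mfun S by exact: bounded_mfun_sum.
have DS0 : \int[P]_w (D w * S w) = 0.
  under eq_Rintegral do rewrite mulr_sumr.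
  rewrite Rintegral_sum; last by move=> k; exact: integrableM_bounded.
  rewrite big1// => k _; rewrite -[RHS](D0 (A k))// [RHS]Rintegral_mkcond.
  apply: eq_Rintegral => w _; rewrite /F indicE patchE.
  by case: (_ \in _); rewrite ?mulr1 ?mulr0.
have ZS w : `|Z w - r * S w| <= r.
  have := sum_threshold_approx (ZK w).
  rewrite (_ : \sum_(k < K) _ = S w); last first.
    apply: eq_bigr => k _; rewrite /F indicE; congr (nat_of_bool _)%:R.
    by apply/idP/idP; rewrite /A ?in_setE//= => /set_mem.
  rewrite lerBlDr ler_pdivrMr// ler_pdivlMr// => /andP[h1 h2].
  rewrite ler_norml; apply/andP; split; nra.
have RB : bounded_mfun (fun w => r * S w).
  by apply: bounded_mfunM => //; exact: bounded_mfun_cst.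
(* [D] integrates to zero against the staircase, so subtracting it from [Z] is free. *)
have -> : \int[P]_w (D w * Z w) = \int[P]_w (D w * (Z w - r * S w)).
  under [RHS]eq_Rintegral do rewrite mulrBr.
  rewrite RintegralB//; [|exact: integrableM_bounded..].
  under [X in _ = _ - X]eq_Rintegral do rewrite mulrCA.
  by rewrite RintegralZl ?DS0 ?mulr0 ?subr0//; exact: integrableM_bounded.
have iDZ : P.-integrable setT (EFin \o (fun w => D w * (Z w - r * S w))).
  by apply: integrableM_bounded => //; exact: bounded_mfunB.
have iaD : P.-integrable setT (EFin \o (fun w => `|D w|)).
  by have := integrable_norm iD.
apply: le_trans (le_normr_Rintegral _ iDZ) _ => //.
apply: le_trans (_ : \int[P]_w (`|D w| * r) <= _).
  apply: le_Rintegral => //.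
  - by have := integrable_norm iDZ.
  - by have := integrableM_bounded iaD (bounded_mfun_cst r).
  - by move=> w _; rewrite normrM ler_wpM2l.
rewrite RintegralZr// -/I /r mulrCA ler_piMr ?(ltW e0)//.
by rewrite ler_pdivrMr ?ltr_wpDl// mul1r lerDl ltW.
Qed.

End BoundedMeasurable.

(** * Translations, lexicographic order and distance on the lattice *)

Section Lattice.
Context {d : nat}.
Implicit Types (a b c i j k : Zd d) (s : seq (Zd d)).

Definition zneg k : Zd d := [tuple - tnth k l | l < d].

Lemma zaddNK i : cancel (fun k => zadd k (zneg i)) (fun k => zadd k i).
Proof. by move=> k; apply: eq_from_tnth => l; rewrite !tnth_mktuple subrK. Qed.

Lemma zaddrK i : cancel (fun k => zadd k i) (fun k => zadd k (zneg i)).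
Proof. by move=> k; apply: eq_from_tnth => l; rewrite !tnth_mktuple addrK. Qed.

Lemma zadd0l i : zadd (zzero d) i = i.
Proof. by apply: eq_from_tnth => l; rewrite !tnth_mktuple add0r. Qed.

Lemma zaddrN i : zadd i (zneg i) = zzero d.
Proof. by apply: eq_from_tnth => l; rewrite !tnth_mktuple subrr. Qed.

Lemma lex_lt_zaddr c a b : lex_lt a b -> lex_lt (zadd a c) (zadd b c).
Proof.
move=> [ab [p [lt_p eq_p]]]; split; first by move=> /(can_inj (zaddrK c)).
exists p; rewrite !tnth_mktuple ltrD2r; split=> // q /eq_p.
by rewrite !tnth_mktuple => ->.
Qed.

Lemma lex_lt_total a b : a != b -> lex_lt a b \/ lex_lt b a.
Proof.
move=> ab; have [p0 p0P] : exists p, tnth a p != tnth b p.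
  apply/existsP; rewrite -negb_forall; apply: contra ab => /forallP eq_ab.
  by apply/eqP/eq_from_tnth => l; exact/eqP.
case: (@arg_minnP _ p0 (fun p => tnth a p != tnth b p) (fun p : 'I_d => p : nat) p0P) => p pP pmin.
have eq_lt (q : 'I_d) : (q < p)%N -> tnth a q = tnth b q.
  by move=> qp; apply/eqP; apply: contraTT qp => /pmin; rewrite -leqNgt.
have [lt_ab|lt_ba|eq_ab] := ltgtP (tnth a p) (tnth b p).
- by left; split; [exact/eqP | exists p].
- right; split; first by move=> ba; rewrite ba eqxx in ab.
  by exists p; split=> // q /eq_lt.
- by rewrite eq_ab eqxx in pP.
Qed.

Lemma lex_lt_trans b a c : lex_lt a b -> lex_lt b c -> lex_lt a c.
Proof.
move=> [_ [p [lt_p eq_p]]] [_ [q [lt_q eq_q]]].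
suff [r [lt_r eq_r]] : exists r : 'I_d, tnth a r < tnth c r /\
    forall l : 'I_d, (l < r)%N -> tnth a l = tnth c l.
  by split; [move=> ac; move: lt_r; rewrite ac ltxx | exists r].
have [pq|qp|/val_inj pq] := ltngtP p q.
- exists p; rewrite -eq_q//; split=> // l lp.
  by rewrite eq_p// eq_q// (ltn_trans lp).
- exists q; rewrite eq_p//; split=> // l lq.
  by rewrite -eq_q// eq_p// (ltn_trans lq).
- exists p; split; first by rewrite (lt_trans lt_p)// pq.
  by move=> l lp; rewrite eq_p// eq_q// -pq.
Qed.

(** Supplies the site removed in the induction: all the others precede it, so after translation they
    lie in the past of the origin. *)
Lemma exists_lex_max s : s != [::] ->
  exists2 i, i \in s & forall j, j \in s -> j != i -> lex_lt j i.
Proof.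
elim: s => // x s IH _; have [->|/IH [i is_ imax]] := eqVneq s [::].
  by exists x; rewrite ?mem_head// => j; rewrite inE => ->.
have [xi|xi] := eqVneq x i.
  exists i; first by rewrite inE is_ orbT.
  by move=> j; rewrite inE xi => /predU1P[->|/imax//]; rewrite eqxx.
have [ltxi|ltix] := lex_lt_total xi.
  exists i; first by rewrite inE is_ orbT.
  by move=> j; rewrite inE => /predU1P[->//|/imax].
exists x; first exact: mem_head.
move=> j; rewrite inE => /predU1P[->|/imax ji _]; first by rewrite eqxx.
have [->//|/ji jlti] := eqVneq j i; exact: lex_lt_trans ltix.
Qed.

Lemma zdistC i j : zdist i j = zdist j i.
Proof. by apply: eq_bigr => l _; rewrite distnC. Qed.

End Lattice.

(** * Elementary bounds for the exponential, and truncation *)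

Section RealExp.
Context {R : realType}.
Implicit Types x y q : R.

(** From [1 - q <= expR (- q)] one gets [expR q <= 1 / (1 - q)], and [(1 - q) (1 + q + 2 q^2) = 1 +
    q^2 (1 - 2 q)] is at least 1. *)
Lemma expR_le_quadratic q : `|q| <= 2^-1 -> expR q <= 1 + q + 2 * q ^+ 2.
Proof.
rewrite ler_norml => /andP[q1 q2].
have e1 : 1 - q <= expR (- q) by exact: expR_ge1Dx.
have e2 : 0 < expR q by exact: expR_gt0.
have : expR q * (1 - q) <= 1.
  by rewrite -[leRHS](expRxMexpNx_1 q) ler_pM2l.
have : 0 < 1 - q by lra.
nra.
Qed.

Lemma norm_expRB1_le q : `|q| <= 2^-1 -> `|expR q - 1| <= 2 * `|q|.
Proof.
move=> q2; have e1 := expR_ge1Dx q; have e2 := expR_le_quadratic q2.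
move: q2; rewrite ler_norml => /andP[qa qb].
have [q0|q0] := leP 0 q.
  by rewrite (ger0_norm q0) ler_norml; apply/andP; split; nra.
by rewrite (ltr0_norm q0) ler_norml; apply/andP; split; nra.
Qed.

Definition clip (M x : R) : R := Num.min M (Num.max (- M) x).

Lemma norm_clip_le M x : 0 <= M -> `|clip M x| <= M.
Proof. by move=> M0; rewrite /clip ler_norml /Num.min /Num.max; do 2 case: ifP; lra. Qed.

Lemma clip_id M x : `|x| <= M -> clip M x = x.
Proof. by rewrite /clip ler_norml /Num.min /Num.max => /andP[]; do 2 case: ifP; lra. Qed.

Lemma measurable_clip M : measurable_fun setT (clip M).
Proof. by apply: measurable_minr => //; apply: measurable_maxr. Qed.

End RealExp.

(** * Consequences of stationarity *)

Section StationaryField.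
Context {dT : measure_display} {T : measurableType dT} {R : realType}.
Context (P : probability T R) (d : nat) (eps : Zd d -> T -> R).
Context (meps : forall i, measurable_fun setT (eps i)).
Context (stat : strictly_stationary P eps).

(** Each side integrates [F] against the law of a vector, and stationarity identifies the two laws.
    Boundedness of [F] gives the integrability used in the change of variables. *)
Lemma stationary_Rintegral (k : Zd d) n (s : n.-tuple (Zd d)) (F : n.-tuple R -> R) :
  measurable_fun setT F -> (exists C, forall v, `|F v| <= C) ->
  \int[P]_w F [tuple eps (tnth s m) w | m < n] =
  \int[P]_w F [tuple eps (zadd (tnth s m) k) w | m < n].
Proof.
move=> mF [C FC].
pose X w := [tuple eps (tnth s m) w | m < n].
pose Y w := [tuple eps (zadd (tnth s m) k) w | m < n].
have mX : measurable_fun setT X.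
  apply/measurable_fun_tnthP => m; rewrite (_ : _ \o _ = eps (tnth s m))//.
  by apply/funext => w /=; rewrite tnth_mktuple.
have mY : measurable_fun setT Y.
  apply/measurable_fun_tnthP => m; rewrite (_ : _ \o _ = eps (zadd (tnth s m) k))//.
  by apply/funext => w /=; rewrite tnth_mktuple.
have mEF : measurable_fun setT (EFin \o F) by exact/measurable_EFinP.
have iF Z : measurable_fun setT Z ->
    P.-integrable (Z @^-1` setT) ((EFin \o F) \o Z).
  move=> mZ; apply: (@bounded_mfun_integrable _ _ _ P (F \o Z)).
  by split; [exact: measurableT_comp | exists C => w; exact: FC].
congr fine.
have H Z : measurable_fun setT Z ->
    (\int[P]_w (F (Z w))%:E = \int[pushforward P Z]_v (F v)%:E)%E.
  by move=> mZ; rewrite (integral_pushforward mZ mEF (iF Z mZ)).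
rewrite (H X mX) (H Y mY).
apply: eq_measure_integral => A mA _; rewrite /pushforward /=.
exact: stat.
Qed.


(** Exceeding [M] is an event about a single site, so stationarity for vectors of length one carries
    its null probability from the origin to [i]. *)
Lemma ae_norm_stationary_le (M : R) : {ae P, forall w, `|eps (zzero d) w| <= M} ->
  forall i, {ae P, forall w, `|eps i w| <= M}.
Proof.
move=> eps0M i.
pose N j := [set w | ~ (`|eps j w| <= M)].
have NE j : N j = (fun w => `|eps j w|) @^-1` `]M, +oo[%classic.
  by apply/seteqP; split => w /=; rewrite in_itv/= andbT ltNge => /negP.
have mN j : measurable (N j).
  rewrite NE -[X in measurable X]setTI.
  have mj : measurable_fun setT (fun w => `|eps j w|) by exact: measurableT_comp.
  exact: mj.
have N0 : P (N (zzero d)) = 0%E by exact/negligibleP.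
suff : P (N i) = 0%E by move/negligibleP => /(_ (mN i)).
rewrite -[RHS]N0.
pose B := [set v : 1.-tuple R | M < `|tnth v ord0|].
have mB : measurable B.
  have m1 : measurable_fun setT (fun v : 1.-tuple R => `|tnth v ord0|).
    by apply: measurableT_comp => //; exact: measurable_tnth.
  have := m1 measurableT `]M, +oo[%classic (measurable_itv _).
  by rewrite setTI; congr measurable; apply/seteqP; split => v /=; rewrite /B/= in_itv/= andbT.
have := stat i [tuple zzero d | m < 1] mB.
rewrite /B /=; under eq_set do rewrite !tnth_mktuple.
under [in X in _ = X -> _]eq_set do rewrite !tnth_mktuple zadd0l.
move=> H; rewrite -[LHS]/(P (N i)).
rewrite !NE.
transitivity (P [set w | M < `|eps i w|]).
  by congr (P _); apply/seteqP; split => w /=; rewrite in_itv/= andbT.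
rewrite -H.
by congr (P _); apply/seteqP; split => w /=; rewrite in_itv/= andbT.
Qed.

(* The field is only almost surely bounded by [M]; clipping bounds it everywhere. *)
Definition clipped (M : R) (k : Zd d) (w : T) : R := clip M (eps k w).

Definition lin_comb (M : R) (a : Zd d -> R) (s : seq (Zd d)) (w : T) : R :=
  \sum_(k <- s) a k * clipped M k w.

Lemma bounded_mfun_clipped M k : 0 <= M -> bounded_mfun (clipped M k).
Proof.
move=> M0; split; first by apply: measurableT_comp => //; exact: measurable_clip.
by exists M => w; exact: norm_clip_le.
Qed.

Lemma bounded_mfun_lin_comb M a s : 0 <= M -> bounded_mfun (lin_comb M a s).
Proof.
move=> M0; apply: bounded_mfun_sum => k.
by apply: bounded_mfunM; [exact: bounded_mfun_cst | exact: bounded_mfun_clipped].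
Qed.

(** Clipping makes the integrand a bounded function of finitely many field values, so it can be
    translated; the shift then reappears in the coefficients. This moves the removed site [i] to the
    origin, where (C1) is stated. *)
Lemma Rintegral_clipped_expR_shift (M : R) (a : Zd d -> R) (i : Zd d) (s : seq (Zd d)) :
  0 <= M ->
  \int[P]_w (clipped M i w * expR (lin_comb M a [seq zadd k i | k <- s] w)) =
  \int[P]_w (clipped M (zzero d) w * expR (lin_comb M (fun k => a (zadd k i)) s w)).
Proof.
move=> M0.
pose t : (size s).+1.-tuple (Zd d) := [tuple of zzero d :: in_tuple s].
pose F (v : (size s).+1.-tuple R) := clip M (tnth v ord0) *
  expR (\sum_(m < size s) a (zadd (tnth (in_tuple s) m) i) * clip M (tnth v (lift ord0 m))).
have mclip m : bounded_mfun (fun v : (size s).+1.-tuple R => clip M (tnth v m)).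
  split; last by exists M => v; exact: norm_clip_le.
  by apply: measurableT_comp; [exact: measurable_clip | exact: measurable_tnth].
have [mF bF] : bounded_mfun F.
  apply: bounded_mfunM => //; apply: bounded_mfun_expR; apply: bounded_mfun_sum => m.
  by apply: bounded_mfunM => //; exact: bounded_mfun_cst.
have := stationary_Rintegral i t mF bF; rewrite /F => H.
transitivity (\int[P]_w F [tuple eps (zadd (tnth t m) i) w | m < (size s).+1]).
  apply: eq_Rintegral => w _; rewrite /F tnth_mktuple /= zadd0l; congr (_ * expR _).
  rewrite /lin_comb big_map big_tnth; apply: eq_bigr => m _.
  by rewrite tnth_mktuple /clipped tnthS.
rewrite -H; apply: eq_Rintegral => w _; rewrite /F tnth_mktuple; congr (_ * expR _).
rewrite /lin_comb [RHS]big_tnth; apply: eq_bigr => m _.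
by rewrite tnth_mktuple /clipped tnthS.
Qed.

End StationaryField.

(** * Comparison of integrals under almost sure relations *)

Section AlmostEverywhere.
Context {dT : measure_display} {T : measurableType dT} {R : realType}.
Context (P : probability T R).

Lemma ae_eq_Rintegral (f g : T -> R) :
  measurable_fun setT f -> measurable_fun setT g ->
  {ae P, forall w, f w = g w} -> \int[P]_w f w = \int[P]_w g w.
Proof.
move=> mf mg fg; congr fine; apply: ae_eq_integral => //.
- exact/measurable_EFinP.
- exact/measurable_EFinP.
- by apply: filterS fg => w /= ->.
Qed.

Lemma ae_le_Rintegral (f g : T -> R) :
  P.-integrable setT (EFin \o f) -> P.-integrable setT (EFin \o g) ->
  (forall w, 0 <= f w) -> (forall w, 0 <= g w) ->
  {ae P, forall w, f w <= g w} -> \int[P]_w f w <= \int[P]_w g w.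
Proof.
move=> fi gi f0 g0 fg; apply: fine_le.
- exact: integrable_fin_num.
- exact: integrable_fin_num.
apply: ae_ge0_le_integral => //.
- by move=> w _; rewrite lee_fin.
- exact: measurable_int fi.
- by move=> w _; rewrite lee_fin.
- exact: measurable_int gi.
- by apply: filterS fg => w fgw _; rewrite lee_fin.
Qed.

End AlmostEverywhere.

Lemma ae_bounded_integrable {dT : measure_display} {T : measurableType dT} {R : realType}
  (P : probability T R) (f : T -> R) (M : R) :
  measurable_fun setT f -> {ae P, forall w, `|f w| <= M} ->
  P.-integrable setT (EFin \o f).
Proof.
move=> mf fM; apply/integrableP; split; first exact/measurable_EFinP.
apply: (@le_lt_trans _ _ (\int[P]_w (`|M|)%:E)%E); last first.
  rewrite integral_cst// [X in (_ * X)%E](_ : _ = 1%E) ?mule1 ?ltry//.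
  exact: probability_setT.
apply: ae_ge0_le_integral => //.
- by apply: measurableT_comp => //; exact/measurable_EFinP.
by apply: filterS fM => w fwM _ /=; rewrite lee_fin (le_trans fwM)// ler_norm.
Qed.

Lemma Rintegral_cst_probability {dT : measure_display} {T : measurableType dT}
  {R : realType} (P : probability T R) (c : R) : \int[P]_w c = c.
Proof.
rewrite Rintegral_cst// [X in fine X](_ : _ = 1%E) ?mulr1//.
exact: probability_setT.
Qed.

(** * Sigma-fields generated by part of the field, and conditional expectation *)

Section SubSigmaAlgebra.
Context {dT : measure_display} {T : measurableType dT} {R : realType}.
Context (d : nat) (eps : Zd d -> T -> R).
Context (meps : forall i, measurable_fun setT (eps i)).

(** The generating family of [sigma_field_of], named so that measurability for that sigma-field can
    be stated on [g_sigma_algebraType]. *)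
Definition field_generators (Gam : set (Zd d)) : set (set T) :=
  [set A | exists j, Gam j /\ exists B : set R, measurable B /\ A = eps j @^-1` B].

Lemma sub_sigma_field_of Gam : sigma_field_of eps Gam `<=` measurable.
Proof.
apply: smallest_sub; first exact: sigma_algebra_measurable.
move=> _ [j [_ [B [mB ->]]]]; rewrite -[X in measurable X]setTI.
exact: meps.
Qed.

Lemma measurable_lin_comb_generators M a s Gam :
  (forall k, k \in s -> Gam k) ->
  measurable_fun setT (lin_comb eps M a s : g_sigma_algebraType (field_generators Gam) -> R).
Proof.
elim: s => [|k s IH] sG; rewrite /lin_comb.
  by under eq_fun do rewrite big_nil; exact: measurable_cst.
under eq_fun do rewrite big_cons.
apply: measurable_funD; last by apply: IH => j js; apply: sG; rewrite inE js orbT.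
apply: measurable_funM; first exact: measurable_cst.
rewrite /clipped; apply: measurableT_comp; first exact: measurable_clip.
move=> _ B mB; rewrite setTI; apply: sub_sigma_algebra.
by exists k; split; [apply: sG; exact: mem_head | exists B].
Qed.

Lemma measurable_sigma_field_of (Gam : set (Zd d)) (Y : T -> R) :
  (forall B : set R, measurable B -> sigma_field_of eps Gam (Y @^-1` B)) ->
  measurable_fun setT Y.
Proof. by move=> mY _ B /mY YB; rewrite setTI; exact: sub_sigma_field_of YB. Qed.

(** [X - Y] integrates to zero over every event of the sigma-field, hence against every bounded
    function measurable for it. *)
Lemma cond_exp_Rintegral (P : probability T R) Gam (X Y Z : T -> R) :
  P.-integrable setT (EFin \o X) ->
  is_cond_exp P (sigma_field_of eps Gam) X Y ->
  measurable_fun setT (Z : g_sigma_algebraType (field_generators Gam) -> R) ->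
  bounded_mfun Z ->
  \int[P]_w (X w * Z w) = \int[P]_w (Y w * Z w).
Proof.
move=> iX [mY [iY XY]] mZ ZB.
have := @Rintegral_mul_measurable0 _ _ _ P (field_generators Gam) (fun w => X w - Y w) Z _ _ _ mZ ZB.
under eq_Rintegral do rewrite mulrBl.
rewrite RintegralB//; [|exact: integrableM_bounded..].
move=> H; apply/eqP; rewrite -subr_eq0; apply/eqP/H.
- exact: sub_sigma_field_of.
- rewrite (_ : EFin \o _ = (EFin \o X) \- (EFin \o Y))%E; first exact: integrableB.
  by apply/funext => w /=; rewrite EFinB.
move=> A GA; have mA : measurable A by exact: sub_sigma_field_of GA.
have sA f : P.-integrable setT f -> P.-integrable A f by exact: integrableS.
by rewrite RintegralB ?sA// /Rintegral XY// subrr.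
Qed.

End SubSigmaAlgebra.

(** * The exponential moment of a weighted sum of field values *)

Section ExponentialInequality.
Context {dT : measure_display} {T : measurableType dT} {R : realType}.
Context (P : probability T R) (d : nat) (eps : Zd d -> T -> R).
Context (meps : forall i, measurable_fun setT (eps i)).
Context (stat : strictly_stationary P eps).
Context (M : R) (M0 : 0 <= M) (eps0M : {ae P, forall w, `|eps (zzero d) w| <= M}).
Context (E0 : ('E_P[eps (zzero d)] = 0)%E).
Context (Y : Zd d -> T -> R) (b : Zd d -> R) (B : R).
Context (HY : forall k, Vset (zzero d) 1 k ->
       is_cond_exp P (sigma_field_of eps (Vset (zzero d) (zdist k (zzero d))))
                   (eps (zzero d)) (Y k)).
Context (b0 : forall k, 0 <= b k).
Context (Hb : forall k, Vset (zzero d) 1 k ->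
  {ae P, forall w, `|eps k w * Y k w| <= b k}).
Context (HB : forall s, uniq s -> (forall k, k \in s -> Vset (zzero d) 1 k) ->
  \sum_(k <- s) b k <= B).

Local Notation zeta := (clipped eps M).
Local Notation lin := (lin_comb eps M).
Local Notation o := (zzero d).

Lemma bounded_mfun_exp_lin a s : bounded_mfun (fun w => expR (lin a s w)).
Proof. exact/bounded_mfun_expR/bounded_mfun_lin_comb. Qed.

Lemma ae_clippedE k : {ae P, forall w, zeta k w = eps k w}.
Proof.
have := ae_norm_stationary_le meps stat eps0M k.
by apply: filterS => w; exact: clip_id.
Qed.

Lemma lin_comb_rcons a s k w : lin a (rcons s k) w = lin a s w + a k * zeta k w.
Proof. by rewrite /lin_comb -cats1 big_cat big_seq1. Qed.

Lemma integrable_eps0 : P.-integrable setT (EFin \o eps o).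
Proof. exact: ae_bounded_integrable eps0M. Qed.

Lemma Rintegral_clipped0 : \int[P]_w zeta o w = 0.
Proof.
rewrite (@ae_eq_Rintegral _ _ _ P _ (eps o))//; last exact: ae_clippedE.
  by rewrite /Rintegral; move: E0; rewrite unlock => ->.
by case: (bounded_mfun_clipped meps o M0).
Qed.

Lemma Vset1 k : lex_lt k o -> Vset o 1 k.
Proof.
move=> ko; split=> //; case: ko => _ [p [ltp _]].
apply: leq_trans (leq_bigmax p); rewrite absz_gt0 subr_eq0.
by move: ltp; rewrite lt_neqAle eq_sym => /andP[].
Qed.

(** Every site involved is in the past at distance at least [|k|], so the increment is measurable
    for the sigma-field defining [Y k], which can replace the value at the origin. The increment is
    at most [2 tau |eps_k|] times the previous exponential, and [|eps_k Y_k| <= b k]. *)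
Lemma clipped_telescope_le (tau : R) a s k :
  0 <= tau -> tau * M <= 2^-1 -> (forall j, `|a j| <= tau) ->
  Vset o 1 k -> (forall j, j \in rcons s k -> Vset o (zdist k o) j) ->
  `|\int[P]_w (zeta o w * (expR (lin a (rcons s k) w) - expR (lin a s w)))|
    <= 2 * tau * b k * \int[P]_w expR (lin a s w).
Proof.
move=> tau0 tauM atau Vk sV.
pose Z w := expR (lin a (rcons s k) w) - expR (lin a s w).
have ZB : bounded_mfun Z by apply: bounded_mfunB; exact: bounded_mfun_exp_lin.
have qb w : `|a k * zeta k w| <= 2^-1.
  rewrite normrM (le_trans _ tauM)// ler_pM//.
  exact: norm_clip_le.
have ZE w : `|Z w| <= 2 * tau * `|zeta k w| * expR (lin a s w).
  rewrite /Z lin_comb_rcons expRD -[X in _ - X]mulr1 -mulrBr normrM.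
  rewrite ger0_norm ?expR_ge0// mulrC ler_wpM2r ?expR_ge0//.
  rewrite (le_trans (norm_expRB1_le (qb w)))// normrM -mulrA ler_wpM2l//.
  by rewrite ler_wpM2r.
have [mY [iY _]] := HY Vk.
have mYk : measurable_fun setT (Y k) by exact: measurable_sigma_field_of mY.
(* The conditional expectation is that of the unclipped variable, so clipping at the origin is
   undone first. *)
have -> : \int[P]_w (zeta o w * Z w) = \int[P]_w (eps o w * Z w).
  apply: ae_eq_Rintegral.
  - by apply: (proj1 (bounded_mfunM (bounded_mfun_clipped meps o M0) ZB)).
  - by apply: measurable_funM => //; case: ZB.
  - by apply: filterS (ae_clippedE o) => w ->.
rewrite (cond_exp_Rintegral meps integrable_eps0 (HY Vk) _ ZB); last first.
  apply: measurable_funB; apply: measurableT_comp => //.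
    exact: measurable_lin_comb_generators.
  apply: measurable_lin_comb_generators => j js; apply: sV.
  by rewrite mem_rcons inE js orbT.
have iYZ := integrableM_bounded iY ZB.
apply: le_trans (le_normr_Rintegral _ iYZ) _ => //.
have iE := bounded_mfun_integrable P (bounded_mfun_exp_lin a s).
rewrite -RintegralZl//; apply: ae_le_Rintegral.
- exact: integrable_norm iYZ.
- apply: (@bounded_mfun_integrable _ _ _ P (fun w => 2 * tau * b k * expR (lin a s w))).
  by apply: bounded_mfunM; [exact: bounded_mfun_cst | exact: bounded_mfun_exp_lin].
- by [].
- by move=> w; rewrite !mulr_ge0 ?expR_ge0.
(* The increment supplies the factor [zeta k], almost surely equal to [eps k]; its product with
   [Y k] is what [b k] bounds. *)
apply: filterS2 (ae_clippedE k) (Hb Vk) => w ek; rewrite -ek normrM => hb.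
rewrite normrM (le_trans (ler_wpM2l _ (ZE w)))//.
rewrite mulrA ler_wpM2r ?expR_ge0// mulrCA ler_wpM2l ?mulr_ge0//.
by rewrite mulrC.
Qed.

(** Telescoping over the prefixes of [s]. The order by decreasing distance ensures that when [k] is
    added, all sites already present are at least as far from the origin, as the bound on one
    increment requires. [H] controls the exponential moments of the prefixes. *)
Lemma clipped_exp_le (tau H : R) a s :
  0 <= tau -> tau * M <= 2^-1 -> (forall j, `|a j| <= tau) -> 
  pairwise (fun x y => zdist y o <= zdist x o)%N s -> uniq s ->
  (forall k, k \in s -> lex_lt k o) ->
  (forall s', uniq s' -> (size s' <= size s)%N -> \int[P]_w expR (lin a s' w) <= H) ->
  `|\int[P]_w (zeta o w * expR (lin a s w))| <= 2 * tau * H * \sum_(k <- s) b k.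
Proof.
move=> tau0 tauM atau; elim/last_ind: s => [|s k IH] sP us sV sH.
  (* Without sites only the mean at the origin remains, and it is zero. *)
  rewrite big_nil mulr0 /lin_comb.
  under eq_Rintegral do rewrite big_nil expR0 mulr1.
  by rewrite Rintegral_clipped0 normr0.
have bz := bounded_mfun_clipped meps o M0.
have be := bounded_mfun_exp_lin a.
under eq_Rintegral => w _ do rewrite -[expR _](subrK (expR (lin a s w))) mulrDr.
rewrite RintegralD//; last 2 first.
- by apply/bounded_mfun_integrable/bounded_mfunM => //; exact: bounded_mfunB.
- by apply/bounded_mfun_integrable/bounded_mfunM.
rewrite (le_trans (ler_normD _ _))// -cats1 big_cat big_seq1 /= mulrDr addrC cats1.
have Vk : Vset o 1 k by apply/Vset1/sV; rewrite mem_rcons mem_head.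
move: sP; rewrite pairwise_rcons => /andP[/allP sk sP].
move: us; rewrite rcons_uniq => /andP[ks us].
apply: lerD.
  apply: IH => //.
    by move=> j js; apply: sV; rewrite mem_rcons inE js orbT.
  by move=> s' us' ss'; apply: sH => //; rewrite size_rcons leqW.
apply: le_trans (clipped_telescope_le tau0 tauM atau Vk _) _.
  move=> j js; split; first exact: sV.
  by rewrite (zdistC o); move: js; rewrite mem_rcons inE => /predU1P[->//|/sk].
rewrite -!mulrA ler_wpM2l// ler_wpM2l// mulrC ler_wpM2r//.
by apply: sH => //; rewrite size_rcons.
Qed.

(** Removing the largest site costs the factor [1 + 2 (tau M)^2 + 2 B tau^2]: the quadratic Taylor
    term plus the covariance term summed by (C1). This equals [1 + C tau^2], which is at most
    [expR (C * tau ^+ 2)]. *)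
Lemma Rintegral_exp_lin_le (tau : R) a s : 0 <= tau -> (forall j, `|a j| <= tau) ->
  uniq s -> \int[P]_w expR (lin a s w) <=
            expR ((2 * M ^+ 2 + 2 * B) * tau ^+ 2 * (size s)%:R).
Proof.
move=> tau0 atau us.
have B0 : 0 <= B by have := HB (s := [::]); rewrite big_nil; exact.
set C := 2 * M ^+ 2 + 2 * B.
have C0 : 0 <= C by rewrite /C; nra.
have [tauM|tauM] := leP (tau * M) 2^-1; last first.
  (* Here [|lin a s| <= tau * M * size s] is already at most the exponent. *)
  have le_exp w : expR (lin a s w) <= expR (C * tau ^+ 2 * (size s)%:R).
    rewrite ler_expR; apply: (@le_trans _ _ (\sum_(k <- s) tau * M)).
      apply: ler_sum => k _; rewrite (le_trans (ler_norm _))// normrM ler_pM//.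
      exact: norm_clip_le.
    rewrite big_const_seq count_predT iter_addr_0 -[leLHS]mulr_natr ler_wpM2r//.
    have : 0 <= tau * M by rewrite mulr_ge0.
    have : 0 <= B * tau ^+ 2 by rewrite mulr_ge0// sqr_ge0.
    rewrite /C; nra.
  apply: le_trans (le_Rintegral _ _ _ (fun w _ => le_exp w)) _ => //.
  - exact/bounded_mfun_integrable/bounded_mfun_exp_lin.
  - exact/bounded_mfun_integrable/bounded_mfun_cst.
  by rewrite Rintegral_cst_probability.
(* The induction is on a bound for the size, since the covariance estimate needs all smaller sets;
   [a] is generalized because translation changes the coefficients. *)
move: {2}(size s) (leqnn (size s)) => n; elim: n => [|n IH] in s a atau us *.
  rewrite leqn0 size_eq0 => /eqP ->; rewrite mulr0 /lin_comb.
  under eq_Rintegral do rewrite big_nil.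
  by rewrite Rintegral_cst_probability expR0.
move=> ssn; have [->|s0] := eqVneq s [::].
  rewrite mulr0 /lin_comb.
  under eq_Rintegral do rewrite big_nil.
  by rewrite Rintegral_cst_probability expR0.
have [i is_ imax] := exists_lex_max s0.
pose s' := rem i s; have us' : uniq s' by exact: rem_uniq.
have sz : size s = (size s').+1 by rewrite size_rem// prednK// lt0n size_eq0.
pose r (x y : Zd d) := (zdist y o <= zdist x o)%N.
(* The remaining sites seen from [i], farthest first. *)
pose t := sort r [seq zadd k (zneg i) | k <- s'].
have st : size t = size s' by rewrite size_sort size_map.
pose a' k := a (zadd k i).
set H := expR (C * tau ^+ 2 * (size s')%:R).
have H0 : 0 <= H by exact: expR_ge0.
have IHs a1 s1 : (forall j, `|a1 j| <= tau) -> uniq s1 -> (size s1 <= size s')%N ->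
    \int[P]_w expR (lin a1 s1 w) <= H.
  move=> a1t us1 ss1; apply: le_trans (IH _ _ a1t us1 _) _.
    by rewrite (leq_trans ss1)// -ltnS -sz.
  by rewrite ler_expR ler_wpM2l ?mulr_ge0 ?sqr_ge0// ler_nat.
have main : `|\int[P]_w (zeta i w * expR (lin a s' w))| <= 2 * tau * H * B.
  have -> : \int[P]_w (zeta i w * expR (lin a s' w)) =
      \int[P]_w (zeta o w * expR (lin a' t w)).
    rewrite -(Rintegral_clipped_expR_shift meps stat a i t M0).
    apply: eq_Rintegral => w _; congr (_ * expR _); apply: perm_big.
    rewrite perm_sym (perm_trans (perm_map _ (permEl (perm_sort _ _))))//.
    by rewrite -map_comp (eq_map (g := id)) ?map_id// => k /=; rewrite zaddNK.
  have ut : uniq t by rewrite sort_uniq map_inj_uniq//; exact: can_inj (zaddNK i).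
  have tV k : k \in t -> lex_lt k o.
    rewrite mem_sort => /mapP[j js' ->]; rewrite -(zaddrN i); apply: lex_lt_zaddr.
    by move: js'; rewrite /s' mem_rem_uniq// inE => /andP[ji js]; exact: imax.
  apply: le_trans (@clipped_exp_le tau H a' t tau0 tauM _ _ ut tV _) _.
  - by move=> j; exact: atau.
  - have rt : transitive r by move=> x y z; rewrite /r => xy /leq_trans; apply.
    rewrite -(sorted_pairwise rt); apply: sort_sorted.
    by move=> x y; rewrite /r leq_total.
  - by move=> s1 us1; rewrite st; apply: IHs => // j; exact: atau.
  rewrite ler_wpM2l ?mulr_ge0//; apply: HB => // k kt.
  exact/Vset1/tV.
have be := bounded_mfun_exp_lin a s'.
have bz := bounded_mfun_clipped meps i M0.
(* The quadratic term is bounded pointwise, but the linear one is kept exact: only its expectation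
   is of order [tau^2]. *)
have ptw w : expR (lin a s w) <=
    (1 + 2 * (tau * M) ^+ 2) * expR (lin a s' w) + a i * (zeta i w * expR (lin a s' w)).
  have -> : lin a s w = lin a s' w + a i * zeta i w.
    rewrite /lin_comb (perm_big _ (perm_to_rem is_)) big_cons addrC//.
  set q := a i * zeta i w.
  have qM : `|q| <= tau * M by rewrite normrM ler_pM//; exact: norm_clip_le.
  have := expR_le_quadratic (le_trans qM tauM).
  have : q ^+ 2 <= (tau * M) ^+ 2.
    by rewrite -real_normK ?num_real// ler_pXn2r// nnegrE// mulr_ge0.
  rewrite expRD mulrA -/q => h1 h2.
  have e0 := expR_ge0 (lin a s' w).
  apply: le_trans (ler_wpM2l e0 h2) _; nra.
apply: le_trans (le_Rintegral _ _ _ (fun w _ => ptw w)) _ => //.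
- exact/bounded_mfun_integrable/bounded_mfun_exp_lin.
- apply/bounded_mfun_integrable/bounded_mfunD; apply: bounded_mfunM => //.
  + exact: bounded_mfun_cst.
  + exact: bounded_mfun_cst.
  + exact: bounded_mfunM.
rewrite RintegralD//; last 2 first.
- by apply/bounded_mfun_integrable/bounded_mfunM => //; exact: bounded_mfun_cst.
- apply/bounded_mfun_integrable/bounded_mfunM; first exact: bounded_mfun_cst.
  exact: bounded_mfunM.
rewrite !RintegralZl//; [|apply/bounded_mfun_integrable..]; last 2 first.
- exact: bounded_mfunM.
- by [].
have h1 := IHs _ _ atau us' (leqnn _).
have h2 : a i * \int[P]_w (zeta i w * expR (lin a s' w)) <= tau * (2 * tau * H * B).
  by rewrite (le_trans (ler_norm _))// normrM ler_pM.
have e1 : expR (C * tau ^+ 2 * (size s)%:R) = H * expR (C * tau ^+ 2).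
  by rewrite sz -natr1 mulrDr mulr1 expRD.
have e2 := expR_ge1Dx (C * tau ^+ 2).
rewrite e1; apply: le_trans (ler_wpM2l H0 e2).
have e3 : 0 <= 1 + 2 * (tau * M) ^+ 2 by rewrite addr_ge0// mulr_ge0// sqr_ge0.
apply: le_trans (lerD (ler_wpM2l e3 h1) h2) _.
rewrite /C; lra.
Qed.

End ExponentialInequality.

(** * Deviation probabilities and Borel-Cantelli *)

Section Deviation.
Context {dT : measure_display} {T : measurableType dT} {R : realType}.
Context (P : probability T R).

(** Exponential Markov inequality: the indicator of the event is at most [expR (f w - x)]. *)
Lemma probability_ge_le_expR (f : T -> R) (x : R) : bounded_mfun f ->
  (P [set w | x <= f w]%R <= (expR (- x) * \int[P]_w expR (f w))%:E)%E.
Proof.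
move=> fB; have [mf _] := fB; set A := [set w | _].
have mA : measurable A.
  have := mf measurableT `[x, +oo[%classic (measurable_itv _).
  by rewrite setTI; congr measurable; apply/seteqP; split => w /=; rewrite /A/= in_itv/= andbT.
have eB := bounded_mfun_expR fB.
have IB : bounded_mfun (\1_A : T -> R).
  split; first exact: measurable_indic.
  by exists 1 => w; rewrite indicE; case: (_ \in _); rewrite ?normr1 ?normr0.
have -> : P A = (\int[P]_w \1_A w)%:E.
  rewrite /Rintegral integral_indic// setIT fineK//.
  exact: fin_num_measure.
rewrite lee_fin -RintegralZl//; last exact: bounded_mfun_integrable.
apply: le_Rintegral => //.
- exact: bounded_mfun_integrable.
- apply: (@bounded_mfun_integrable _ _ _ P (fun w => expR (- x) * expR (f w))).
  by apply: bounded_mfunM => //; exact: bounded_mfun_cst.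
move=> w _; rewrite -expRD indicE; case: (boolP (w \in A)) => /= [|_].
  by rewrite in_setE /A /= => xf; rewrite -expR0 ler_expR; lra.
exact: expR_ge0.
Qed.

(** Borel-Cantelli, with a summable bound whose partial sums telescope to [1 - 1 / (k + 1)]. *)
Lemma lim_sup_set_null (F : nat -> set T) :
  (forall n, measurable (F n)) ->
  (forall n, (P (F n) <= ((n.+1 * n.+2)%:R^-1)%:E)%E) ->
  {ae P, forall w, exists n0, forall n, (n0 <= n)%N -> ~ F n w}.
Proof.
move=> mF PF.
have sum_le k : \sum_(n < k) ((n.+1 * n.+2)%:R^-1 : R) = 1 - k.+1%:R^-1.
  elim: k => [|k IH]; first by rewrite big_ord0 invr1 subrr.
  rewrite big_ord_recr /= IH natrM.
  have k0 : (0 : R) <= k%:R by [].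
  by rewrite -[k.+2%:R]natr1 -[k.+1%:R]natr1; field; lra.
have : P (lim_sup_set F) = 0%E.
  apply: lim_sup_set_cvg0 => //.
  apply: (@le_lt_trans _ _ 1%:E); last exact: ltry.
  apply: lime_le; first exact: is_cvg_nneseries.
  apply: nearW => k; rewrite big_mkord.
  apply: (@le_trans _ _ (\sum_(n < k) ((n.+1 * n.+2)%:R^-1)%:E)%E).
    by apply: lee_sum => n _; exact: PF.
  by rewrite sumEFin lee_fin sum_le gerBl invr_ge0.
have mL : measurable (lim_sup_set F).
  by apply: bigcap_measurable => // k _; apply: bigcup_measurable => j /= _.
move=> /(negligibleP _ mL); apply: negligibleS => w /= nw n _.
apply: contrapT => H; apply: nw; exists n => k nk Fk; apply: H.
by exists k.
Qed.

End Deviation.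

Section FieldDeviation.
Context {dT : measure_display} {T : measurableType dT} {R : realType}.
Context (P : probability T R) (d : nat) (eps : Zd d -> T -> R).

(** Chernoff bound applied to the coefficients [t a] and [- t a], one for each tail, whence the
    factor 2. *)
Lemma probability_lin_comb_le (M V : R) (a : Zd d -> R) s (tau L lam : R) :
  (forall i, measurable_fun setT (eps i)) -> 0 <= M ->
  (forall a' s' t, 0 <= t -> (forall j, `|a' j| <= t) -> uniq s' ->
     \int[P]_w expR (lin_comb eps M a' s' w) <= expR (V * t ^+ 2 * (size s')%:R)) ->
  0 <= L -> 0 <= tau -> (forall j, `|a j| <= tau) -> uniq s -> (0 < size s)%N ->
  (P [set w | lam * Num.sqrt (L * (size s)%:R) < `|lin_comb eps M a s w|]%R
     <= (2 * expR ((V * tau ^+ 2 - lam) * L))%:E)%E.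
Proof.
move=> meps M0 HE L0 tau0 atau us s0.
set N := (size s)%:R : R; have N0 : 0 < N by rewrite ltr0n.
(* With this [t] the rescaled threshold is [lam L] and the exponent [V (t tau)^2 N] is [V tau^2 L],
   both proportional to [L]. *)
pose t := Num.sqrt (L / N).
have t0 : 0 <= t by exact: sqrtr_ge0.
have t2 : t ^+ 2 = L / N by rewrite sqr_sqrtr// divr_ge0// ltW.
have tN : t * Num.sqrt (L * N) = L.
  rewrite -sqrtrM ?divr_ge0 ?(ltW N0)//.
  rewrite (_ : L / N * (L * N) = L ^+ 2) ?sqrtr_sqr ?ger0_norm//.
  by field; rewrite gt_eqF.
have linZ c w : lin_comb eps M (fun j => c * a j) s w = c * lin_comb eps M a s w.
  by rewrite /lin_comb mulr_sumr; apply: eq_bigr => k _; rewrite mulrA.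
have one_side (c : R) : `|c| = t ->
    (P [set w | lam * L <= lin_comb eps M (fun j => c * a j) s w]%R
       <= (expR ((V * tau ^+ 2 - lam) * L))%:E)%E.
  move=> ct; apply: le_trans (probability_ge_le_expR P _ (bounded_mfun_lin_comb meps _ _ M0)) _.
  rewrite lee_fin (le_trans (ler_wpM2l (expR_ge0 _) (HE _ s (t * tau) _ _ us)))//.
  - exact: mulr_ge0.
  - by move=> j; rewrite normrM ct ler_wpM2l.
  rewrite -expRD ler_expR exprMn t2 -/N le_eqVlt; apply/orP; left; apply/eqP.
  by field; rewrite gt_eqF.
have mlin c : measurable_fun setT (lin_comb eps M (fun j => c * a j) s).
  by case: (bounded_mfun_lin_comb meps (fun j => c * a j) s M0).
have mset c : measurable [set w | lam * L <= lin_comb eps M (fun j => c * a j) s w].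
  have := mlin c measurableT `[lam * L, +oo[%classic (measurable_itv _).
  by rewrite setTI; congr measurable; apply/seteqP; split => w /=; rewrite in_itv/= andbT.
have mabs : measurable [set w | lam * Num.sqrt (L * N) < `|lin_comb eps M a s w|].
  have ma : measurable_fun setT (fun w => `|lin_comb eps M a s w|).
    by apply: measurableT_comp => //; case: (bounded_mfun_lin_comb meps a s M0).
  have := ma measurableT `]lam * Num.sqrt (L * N), +oo[%classic (measurable_itv _).
  by rewrite setTI; congr measurable; apply/seteqP; split => w /=; rewrite in_itv/= andbT.
apply: (@le_trans _ _ (P ([set w | lam * L <= lin_comb eps M (fun j => t * a j) s w] `|`
    [set w | lam * L <= lin_comb eps M (fun j => (- t) * a j) s w]))).
  apply: le_measure; rewrite ?inE//; first exact: measurableU.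
  move=> w /= /ltW /(ler_wpM2l t0); rewrite mulrCA tN !linZ => h.
  have [l0|l0] := leP 0 (lin_comb eps M a s w).
    by left; rewrite ger0_norm in h.
  by right; rewrite ltr0_norm// mulrN -mulNr in h.
apply: le_trans (measureU2 _ (mset _) (mset _)) _.
rewrite mulr2n mulrDl mul1r EFinD; apply: leeD; apply: one_side.
  by rewrite ger0_norm.
by rewrite normrN ger0_norm.
Qed.

End FieldDeviation.

(** * Active sites and the division of the cube into cells *)

Section ActiveSites.
Context {R : realType} {d : nat}.
Implicit Types (x y : Rd R d).

Lemma rnorm_leP (r : R) x : 0 <= r ->
  reflect (forall l, `|tnth x l| <= r) (rnorm x <= r).
Proof.
move=> r0; apply: (iffP (bigmax_leP _ _ _ _)) => [[_ H] l|H]; first exact: H.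
by split.
Qed.

(** For [h > 0] and a kernel as in (A1), these are the sites of nonzero weight; [j] encodes the site
    with coordinates [j_l + 1]. *)
Definition active n (h : R) x (j : d.-tuple 'I_n) : bool :=
  [forall l, `|tnth x l - (tnth j l).+1%:R / n%:R| <= h].

Definition active_sites n (h : R) x : seq (Zd d) :=
  [seq lam_idx j | j <- enum (@active n h x)].

Lemma lam_idx_inj n : injective (@lam_idx d n).
Proof.
move=> i j /(congr1 (fun t => tnth t _)) ij; apply: eq_from_tnth => l.
by have := ij l; rewrite !tnth_mktuple => /addIr [] /val_inj.
Qed.

Lemma active_sites_uniq n h x : uniq (active_sites n h x).
Proof. by rewrite map_inj_uniq ?enum_uniq//; exact: lam_idx_inj. Qed.

Lemma mem_active n h x (j : d.-tuple 'I_n) : (j \in @active n h x) = active h x j.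
Proof. by []. Qed.

Lemma size_active_sites n h x : size (active_sites n h x) = #|@active n h x|.
Proof. by rewrite size_map cardE. Qed.

Lemma eq_active_sites n h x y : @active n h x =1 @active n h y ->
  active_sites n h x = active_sites n h y.
Proof. by move=> xy; rewrite /active_sites (eq_enum xy). Qed.

(* [kweight n K h x k] is [K (scaled n (h n) x k)]. *)
Definition scaled n (h : R) x (k : Zd d) : Rd R d :=
  [tuple (tnth x l - tnth (scale_idx R n k) l) / h | l < d].

Lemma tnth_scaled_lam_idx n h x (j : d.-tuple 'I_n) l :
  tnth (scaled n h x (lam_idx j)) l = (tnth x l - (tnth j l).+1%:R / n%:R) / h.
Proof. by rewrite !tnth_mktuple intrD -pmulrn natr1. Qed.

Lemma rnorm_scaled_le1 n h x (j : d.-tuple 'I_n) : 0 < h ->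
  (rnorm (scaled n h x (lam_idx j)) <= 1) = active h x j.
Proof.
move=> h0; apply/rnorm_leP/forallP => // H l; have := H l;
  rewrite tnth_scaled_lam_idx normrM normfV (gtr0_norm h0) ler_pdivrMr ?mul1r//.
Qed.

Lemma rnorm_scaledB_le n h x y (k : Zd d) (r : R) : 0 < h -> 0 <= r ->
  (forall l, `|tnth x l - tnth y l| <= r) ->
  rnorm [tuple tnth (scaled n h x k) l - tnth (scaled n h y k) l | l < d] <= r / h.
Proof.
move=> h0 r0 xy; apply/rnorm_leP; first by rewrite divr_ge0// ltW.
move=> l; rewrite !tnth_mktuple -mulrBl opprB addrA subrK.
by rewrite normrM normfV (gtr0_norm h0) ler_pM2r ?invr_gt0.
Qed.

(* The first two components determine the active sites: [|u - i/n| <= h] iff [i <= n (u + h)] and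
   [n - i <= n (1 - u + h)]; the third one locates [x]. *)
Definition cell n m (h : R) x : d.-tuple ('I_(2 * n).+1 * 'I_(2 * n).+1 * 'I_m.+1) :=
  [tuple (inord (Num.truncn (n%:R * (tnth x l + h))),
          inord (Num.truncn (n%:R * (1 - tnth x l + h))),
          inord (Num.truncn (m%:R * tnth x l))) | l < d].

Lemma dist_grid_le n (i : nat) (h u : R) : (0 < n)%N -> (i <= n)%N -> 0 <= h -> 0 <= u <= 1 ->
  (`|u - i%:R / n%:R| <= h) =
  (i <= Num.truncn (n%:R * (u + h)))%N && (n - i <= Num.truncn (n%:R * (1 - u + h)))%N.
Proof.
move=> n0 ile h0 /andP[u0 u1]; have n0' : 0 < n%:R :> R by rewrite ltr0n.
have a1 : 0 <= n%:R * (u + h) by rewrite mulr_ge0// addr_ge0.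
have a2 : 0 <= n%:R * (1 - u + h) by rewrite mulr_ge0// addr_ge0// subr_ge0.
rewrite !truncn_ge_nat// natrB//.
rewrite distrC ler_distl andbC; congr (_ && _).
  by rewrite ler_pdivrMr// mulrC.
rewrite ler_pdivlMr// mulrC; apply/idP/idP; lra.
Qed.

Lemma cell_eqP n m h x y : (0 < n)%N -> (0 < m)%N -> 0 <= h <= 1 ->
  unit_cube x -> unit_cube y -> cell n m h x = cell n m h y ->
  @active n h x =1 @active n h y /\ forall l, `|tnth x l - tnth y l| <= m%:R^-1.
Proof.
move=> n0 m0 /andP[h0 h1] cx cy xy.
have n0' : 0 < n%:R :> R by rewrite ltr0n.
have m0' : 0 < m%:R :> R by rewrite ltr0n.
have H l : [/\ Num.truncn (n%:R * (tnth x l + h)) = Num.truncn (n%:R * (tnth y l + h)),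
     Num.truncn (n%:R * (1 - tnth x l + h)) = Num.truncn (n%:R * (1 - tnth y l + h)) &
     Num.truncn (m%:R * tnth x l) = Num.truncn (m%:R * tnth y l)].
  have /andP[x0 x1] := cx l; have /andP[y0 y1] := cy l.
  (* Since [h <= 1], the truncations stay within the ranges of the ordinals, so [inord] returns them
     rather than its default. *)
  have bx (u : R) : 0 <= u <= 1 -> (Num.truncn (n%:R * (u + h)) < (2 * n).+1)%N.
    move=> /andP[u0 u1]; rewrite truncn_lt_nat ?mulr_ge0 ?addr_ge0// -natr1 natrM; nra.
  have bm (u : R) : 0 <= u <= 1 -> (Num.truncn (m%:R * u) < m.+1)%N.
    move=> /andP[u0 u1]; rewrite truncn_lt_nat ?mulr_ge0// -natr1; nra.
  have : tnth (cell n m h x) l = tnth (cell n m h y) l by rewrite xy.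
  rewrite !tnth_mktuple => -[/(congr1 val) e1 /(congr1 val) e2 /(congr1 val) e3].
  have cx' : 0 <= 1 - tnth x l <= 1 by apply/andP; split; lra.
  have cy' : 0 <= 1 - tnth y l <= 1 by apply/andP; split; lra.
  move: e1 e2 e3; rewrite /= !inordK; first by [].
  - exact: bm _ (cy l).
  - exact: bm _ (cx l).
  - exact: bx _ cy'.
  - exact: bx _ cx'.
  - exact: bx _ (cy l).
  - exact: bx _ (cx l).
split=> [j|l].
  apply: eq_forallb => l; rewrite !dist_grid_le//; try exact: ltn_ord.
  by have [-> -> _] := H l.
have [_ _ e] := H l.
have /andP[x0 x1] := cx l; have /andP[y0 y1] := cy l.
have := truncn_itv (mulr_ge0 (ltW m0') x0); have := truncn_itv (mulr_ge0 (ltW m0') y0).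
rewrite e -natr1 => /andP[a1 a2] /andP[a3 a4].
rewrite -(ler_pM2l m0') mulfV ?gt_eqF// -[X in X * _](gtr0_norm m0') -normrM mulrBr.
by rewrite ler_norml; apply/andP; split; lra.
Qed.

(** Per coordinate the three factors are at most [n^2], [n^2] and [n^(d+2)]; [2 n + 1 <= n^2] needs
    [n >= 3]. *)
Lemma card_cell_le n : (3 <= n)%N ->
  (#|{: d.-tuple ('I_(2 * n).+1 * 'I_(2 * n).+1 * 'I_(n ^ d.+1).+1)}| <= n ^ ((d + 6) * d))%N.
Proof.
move=> n3; rewrite card_tuple !card_prod !card_ord expnM.
case: (posnP d) => [->//|d0]; rewrite leq_exp2r//.
rewrite (_ : (d + 6 = 2 + 2 + d.+2)%N); last by lia.
have e2 : ((2 * n).+1 <= n ^ 2)%N by rewrite -mulnn; nia.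
have e3 : ((n ^ d.+1).+1 <= n ^ d.+2)%N.
  rewrite [(n ^ d.+2)%N]expnS.
  have : (0 < n ^ d.+1)%N by rewrite expn_gt0; lia.
  by move: (n ^ d.+1)%N => p p0; nia.
by rewrite !expnD !leq_mul.
Qed.

(** There is room for the grid points on one side of [u]: to the right if [u <= 1/2], to the left
    otherwise, because [h <= 1/2]. *)
Lemma exists_active_coord n (u h : R) : (0 < n)%N -> 0 <= u <= 1 -> 0 < h <= 2^-1 ->
  exists g : 'I_(Num.truncn (n%:R * h)) -> 'I_n, injective g /\
    forall i, `|u - (g i).+1%:R / n%:R| <= h.
Proof.
case: n => // n _ /andP[u0 u1] /andP[h0 h1].
set N : R := n.+1%:R; have N0 : 0 < N by rewrite ltr0n.
set k := Num.truncn (N * h); set t := Num.truncn (N * u).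
have /andP[k1 _] : k%:R <= N * h < k.+1%:R by rewrite truncn_itv// mulr_ge0// ltW.
have /andP[t1 t2] : t%:R <= N * u < t.+1%:R by rewrite truncn_itv// mulr_ge0// ltW.
rewrite -natr1 in t2.
have dist (j : nat) : N * (u - h) <= j%:R <= N * (u + h) -> `|u - j%:R / N| <= h.
  move=> /andP[i1 i2]; rewrite distrC ler_distl ler_pdivrMr// ler_pdivlMr//.
  by apply/andP; split; lra.
have [u2|u2] := leP u 2^-1.
  have ltn_g (i : 'I_k) : (t + i < n.+1)%N.
    rewrite -(ltr_nat R) natrD -/N; have : (i.+1)%:R <= k%:R :> R by rewrite ler_nat.
    by rewrite -natr1; nra.
  exists (fun i => inord (t + i)); split.
    move=> i z /(congr1 val) /=; rewrite !inordK//.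
    by move=> /addnI /val_inj.
  move=> i; rewrite inordK//; apply: dist; rewrite -addnS natrD.
  have : (i.+1)%:R <= k%:R :> R by rewrite ler_nat.
  have : 1 <= (i.+1)%:R :> R by rewrite ler1n.
  by move=> ? ?; apply/andP; split; nra.
have y_lt (i : 'I_k) : (i < t)%N.
  rewrite -(ltr_nat R); have : (i.+1)%:R <= k%:R :> R by rewrite ler_nat.
  rewrite -natr1; nra.
have t_le : (t <= n.+1)%N by rewrite -(ler_nat R) -/N; nra.
have ltn_g (i : 'I_k) : (t - i.+1 < n.+1)%N by have := y_lt i; lia.
exists (fun i => inord (t - i.+1)); split.
  move=> i z /(congr1 val) /=; rewrite !inordK//.
  by have := y_lt i; have := y_lt z => ? ? ?; apply: val_inj => /=; lia.
move=> i; rewrite inordK// subnSK//; apply: dist; rewrite natrB ?(ltnW (y_lt i))//.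
have : (i.+1)%:R <= k%:R :> R by rewrite ler_nat.
rewrite -natr1 => ?; have : 0 <= i%:R :> R by [].
by move=> ?; apply/andP; split; nra.
Qed.

(** Activity is a condition on each coordinate separately, so the one-dimensional injections combine
    into an injection of tuples. *)
Lemma card_active_ge n (h : R) x : (0 < n)%N -> unit_cube x -> 0 < h <= 2^-1 ->
  (Num.truncn (n%:R * h) ^ d <= #|@active n h x|)%N.
Proof.
move=> n0 cx h01; set k := Num.truncn _.
have /choice[g gP] : forall l : 'I_d, exists g : 'I_k -> 'I_n, injective g /\
    forall i, `|tnth x l - (g i).+1%:R / n%:R| <= h.
  by move=> l; apply: exists_active_coord => //; exact: cx.
pose f (i : d.-tuple 'I_k) : d.-tuple 'I_n := [tuple g l (tnth i l) | l < d].
have f_inj : injective f.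
  move=> i z /(congr1 (fun t => tnth t _)) yz; apply: eq_from_tnth => l.
  by have := yz l; rewrite !tnth_mktuple; apply: (gP l).1.
rewrite -[k in (k ^ _)%N]card_ord -card_tuple -(card_codom f_inj).
apply: subset_leq_card; apply/fintype.subsetP => _ /codomP[i ->].
by apply/forallP => l; rewrite tnth_mktuple; apply: (gP l).2.
Qed.

End ActiveSites.

(** * Kernel sums and their variation within a cell *)

Section KernelSums.
Context {R : realType} {d : nat} (K : Rd R d -> R) (c C eta : R).
Context (c0 : 0 < c) (C0 : 0 < C) (eta0 : 0 < eta).
Context (K0 : forall x, 1 < rnorm x -> K x = 0).
Context (Klip : forall x y, rnorm x <= 1 -> rnorm y <= 1 ->
  `|K x - K y| <= eta * rnorm [tuple tnth x l - tnth y l | l < d]).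
Context (Kbnd : forall x, rnorm x <= 1 -> c <= K x <= C).

Lemma norm_kernel_le x : `|K x| <= C.
Proof.
have [x1|x1] := leP (rnorm x) 1; last by rewrite K0// normr0 ltW.
have /andP[cK KC] := Kbnd x1.
by rewrite ger0_norm// (le_trans (ltW c0)).
Qed.

Lemma sum_kernel_active n h x (f : Zd d -> R) : 0 < h ->
  \sum_(j : d.-tuple 'I_n) f (lam_idx j) * K (scaled n h x (lam_idx j)) =
  \sum_(k <- active_sites n h x) f k * K (scaled n h x k).
Proof.
move=> h0; rewrite big_map big_enum [RHS]big_mkcond; apply: eq_bigr => j _.
rewrite mem_active -rnorm_scaled_le1//; case: leP => // x1.
by rewrite K0// mulr0.
Qed.

Lemma sum_kernel_ge n h x : 0 < h ->
  c * (size (active_sites n h x))%:R <= \sum_(j : d.-tuple 'I_n) K (scaled n h x (lam_idx j)).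
Proof.
move=> h0; have := @sum_kernel_active n h x (fun _ => 1) h0.
under eq_bigr do rewrite mul1r; move=> ->.
rewrite big_map big_enum size_active_sites mulr_natr -sumr_const.
apply: ler_sum => j; rewrite mem_active -rnorm_scaled_le1// => /Kbnd /andP[].
by rewrite mul1r.
Qed.

(** With equal active sets, every contributing site is scaled into the support from both [x] and
    [y], so the Lipschitz bound applies and no jump of [K] occurs. Only the numerator is moved to
    [y]; the denominator at [x] is bounded below by [c N]. *)
Lemma kernel_ratio_le n h (x y : Rd R d) (r M : R) (z : Zd d -> R) : 0 < h -> 0 <= r -> 0 <= M ->
  @active _ _ n h x =1 @active _ _ n h y ->
  (forall l, `|tnth x l - tnth y l| <= r) -> (forall k, `|z k| <= M) ->
  (0 < size (active_sites n h y))%N ->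
  `|(\sum_(j : d.-tuple 'I_n) z (lam_idx j) * K (scaled n h x (lam_idx j))) /
    (\sum_(j : d.-tuple 'I_n) K (scaled n h x (lam_idx j)))| <=
  `|\sum_(k <- active_sites n h y) K (scaled n h y k) * z k| /
     (c * (size (active_sites n h y))%:R) + M * eta * (r / h) / c.
Proof.
move=> h0 r0 M0 xy rxy zM; set N := (size _)%:R => N0.
have N0' : 0 < N by rewrite ltr0n.
have cN : 0 < c * N by rewrite mulr_gt0.
rewrite normrM normfV.
have W0 := @sum_kernel_ge n h x h0; rewrite (eq_active_sites xy) -/N in W0.
set W := \sum_j _ in W0 *.
have Wp : 0 < W by apply: lt_le_trans W0.
rewrite (gtr0_norm Wp) (sum_kernel_active _ _ _ h0) (eq_active_sites xy).
have le_num : `|\sum_(k <- active_sites n h y) z k * K (scaled n h x k)| <=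
    `|\sum_(k <- active_sites n h y) K (scaled n h y k) * z k| + N * (M * (eta * (r / h))).
  rewrite -[X in `|X| <= _](subrK (\sum_(k <- active_sites n h y) K (scaled n h y k) * z k)).
  rewrite (le_trans (ler_normD _ _))// addrC lerD2l -sumrB.
  apply: le_trans (ler_norm_sum _ _ _) _.
  rewrite /N size_active_sites mulr_natl -sumr_const big_map big_enum.
  apply: ler_sum => j; rewrite mem_active => aj.
  rewrite [K _ * _]mulrC -mulrBr normrM ler_pM//.
  apply: le_trans (Klip _ _) _; rewrite ?rnorm_scaled_le1// ?xy//.
  by rewrite ler_wpM2l ?(ltW eta0)//; exact: rnorm_scaledB_le.
have -> : M * eta * (r / h) / c = N * (M * (eta * (r / h))) / (c * N).
  by field; rewrite !gt_eqF.
rewrite -mulrDl; apply: ler_pM => //; first by rewrite invr_ge0 ltW.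
by rewrite lef_pV2.
Qed.

End KernelSums.

(** For [u >= 1] the integer part [k] satisfies [u <= 2 k <= 4 k]; the factor 4 is a square, which
    gives the [2] for each dimension. *)
Lemma sqrt_expr_le {R : realType} (d N : nat) (u : R) : 1 <= u ->
  (Num.truncn u ^ d <= N)%N -> Num.sqrt u ^+ d <= 2 ^+ d * Num.sqrt N%:R.
Proof.
move=> u1 kN; set k := Num.truncn u in kN.
have u0 : 0 <= u by lra.
have k1 : (0 < k)%N by rewrite truncn_gt0.
have uk : u <= 2 ^+ 2 * k%:R.
  have /andP[_] := truncn_itv u0; rewrite -/k -natr1.
  have : 1 <= k%:R :> R by rewrite ler1n.
  lra.
have su : Num.sqrt u <= 2 * Num.sqrt k%:R.
  apply: le_trans (ler_wsqrtr uk) _.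
  by rewrite sqrtrM ?exprn_ge0// sqrtr_sqr ger0_norm.
apply: (@le_trans _ _ ((2 * Num.sqrt k%:R) ^+ d)).
  by apply: lerXn2r => //; rewrite nnegrE ?mulr_ge0// sqrtr_ge0.
rewrite exprMn ler_wpM2l ?exprn_ge0//.
rewrite -[leLHS]ger0_norm ?exprn_ge0 ?sqrtr_ge0// -sqrtr_sqr.
by apply: ler_wsqrtr; rewrite exprAC sqr_sqrtr// -natrX ler_nat.
Qed.

(* Since [m = n^(d+1)], the discretisation error [1 / (m h)] is at most [n^-d]. *)
Lemma noise_rate_le {R : realType} (d n N : nat) (h L lam A c : R) :
  (0 < n)%N -> 0 < h <= 2^-1 -> 1 <= n%:R * h -> 1 <= L -> 0 < c -> 0 <= lam -> 0 <= A ->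
  (Num.truncn (n%:R * h) ^ d <= N)%N ->
  lam * Num.sqrt (L * N%:R) / (c * N%:R) + A * ((n ^ d.+1)%:R^-1 / h) / c <=
  (lam * 2 ^+ d / c + A / c) * (Num.sqrt L / Num.sqrt (n%:R * h) ^+ d).
Proof.
move=> n0 /andP[h0 h2] nh1 L1 c0 lam0 A0 kN.
have L0 : 0 <= L by lra.
have sq := sqrt_expr_le nh1 kN.
have N0 : (0 < N)%N.
  by apply: leq_trans kN; rewrite expn_gt0 truncn_gt0 nh1.
have n0' : 1 <= n%:R :> R by rewrite ler1n.
set p := Num.sqrt (n%:R * h) ^+ d in sq *; set q := Num.sqrt N%:R in sq *.
set s := Num.sqrt L.
have s1 : 1 <= s by rewrite -[leLHS]sqrtr1 ler_wsqrtr.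
have p0 : 0 < p by rewrite exprn_gt0// sqrtr_gt0; lra.
have q0 : 0 < q by rewrite sqrtr_gt0 ltr0n.
have q2 : N%:R = q ^+ 2 by rewrite sqr_sqrtr.
have t0 : 0 < 2 ^+ d :> R by rewrite exprn_gt0.
rewrite mulrDl; apply: lerD.
  rewrite sqrtrM// -/s -/q q2.
  have -> : lam * (s * q) / (c * q ^+ 2) = lam * s / c * q^-1.
    by field; rewrite !gt_eqF.
  have -> : lam * 2 ^+ d / c * (s / p) = lam * s / c * (2 ^+ d / p).
    by field; rewrite !gt_eqF.
  apply: ler_wpM2l; first by rewrite divr_ge0 ?mulr_ge0 ?(ltW c0)//; lra.
  by rewrite ler_pdivlMr// mulrC ler_pdivrMr.
(* As [n h <= n^2], [p] is at most [n^d]; with [n h >= 1] this gives [p <= n^(d+1) h]. *)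
have pn : p <= (n ^ d)%:R.
  rewrite natrX; apply: lerXn2r; rewrite ?nnegrE ?sqrtr_ge0//.
  rewrite -[leRHS](@ger0_norm _ n%:R)// -sqrtr_sqr; apply: ler_wsqrtr.
  nra.
rewrite [leLHS]mulrAC ler_wpM2l//; first by rewrite divr_ge0// ltW.
rewrite expnS natrM -invfM.
have m1 : p <= n%:R * (n ^ d)%:R * h.
  by rewrite mulrAC; apply: le_trans pn _; rewrite ler_peMl.
apply: (@le_trans _ _ p^-1); first by rewrite lef_pV2// posrE (lt_le_trans p0).
by rewrite ler_peMl// invr_ge0 ltW.
Qed.

(** * Centering of the estimator *)

Section CenteredEstimator.
Context {dT : measure_display} {T : measurableType dT} {R : realType}.
Context (P : probability T R) (d : nat) (eps : Zd d -> T -> R).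

(** The regression part is deterministic and cancels; the rest is linear in the centered field. The
    convention [x / 0 = 0] covers a vanishing denominator. *)
Lemma g_est_centered (g K : Rd R d -> R) (h : nat -> R) n x w :
  (forall k, P.-integrable setT (EFin \o eps k)) ->
  (forall k, \int[P]_w eps k w = 0) ->
  ((g_est g eps K h n x w)%:E - 'E_P[g_est g eps K h n x])%E =
  ((\sum_(j : d.-tuple 'I_n) eps (lam_idx j) w * K (scaled n (h n) x (lam_idx j))) /
    (\sum_(j : d.-tuple 'I_n) K (scaled n (h n) x (lam_idx j))))%:E.
Proof.
move=> ieps eps0.
pose W := \sum_(j : d.-tuple 'I_n) K (scaled n (h n) x (lam_idx j)).
pose c := (\sum_(j : d.-tuple 'I_n) g (scale_idx R n (lam_idx j)) *
  K (scaled n (h n) x (lam_idx j))) / W.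
pose F (j : d.-tuple 'I_n) v := K (scaled n (h n) x (lam_idx j)) / W * eps (lam_idx j) v.
have gE v : g_est g eps K h n x v = c + \sum_j F j v.
  rewrite /g_est /c /F -/W; under eq_bigr do rewrite mulrDl.
  rewrite big_split mulrDl /=; congr (_ + _).
  by rewrite mulr_suml; apply: eq_bigr => j _; rewrite -mulrA mulrC.
have iF j : P.-integrable setT (EFin \o F j).
  rewrite (_ : EFin \o _ = (fun v => (K (scaled n (h n) x (lam_idx j)) / W)%:E *
      (EFin \o eps (lam_idx j)) v)%E); first exact: integrableZl.
  by apply/funext => v /=; rewrite /F EFinM.
have -> : ('E_P[g_est g eps K h n x] = c%:E)%E.
  have iS : P.-integrable setT (EFin \o (fun v => \sum_j F j v)).
    rewrite (_ : EFin \o _ = (fun v => \sum_(j <- index_enum _) (EFin \o F j) v)%E).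
      exact: integrable_sum.
    by apply/funext => v /=; rewrite sumEFin.
  have ic : P.-integrable setT (EFin \o (fun _ : T => c)).
    exact/bounded_mfun_integrable/bounded_mfun_cst.
  have ig : P.-integrable setT (EFin \o g_est g eps K h n x).
    rewrite (_ : EFin \o _ = (EFin \o (fun _ : T => c)) \+
      (EFin \o (fun v => (\sum_j F j v)%R)))%E; first exact: integrableD.
    by apply/funext => v /=; rewrite gE EFinD.
  rewrite unlock -[LHS]fineK ?integrable_fin_num//; congr EFin.
  transitivity (\int[P]_v (c + \sum_j F j v)); first by apply: eq_Rintegral => v _; exact: gE.
  rewrite RintegralD// Rintegral_cst_probability (Rintegral_sum _ iF) big1 ?addr0// => j _.
  by rewrite RintegralZl// eps0 mulr0.
rewrite -EFinB gE addrC addKr; congr EFin.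
by rewrite mulr_suml; apply: eq_bigr => j _; rewrite /F mulrAC [K _ * _]mulrC.
Qed.

End CenteredEstimator.

(** * The union over cells and the uniform almost sure bound *)

Lemma probability_bigsetU_le {dT : measure_display} {T : measurableType dT} {R : realType}
  (P : probability T R) (I : finType) (A : I -> set T) (r : R) :
  (forall i, measurable (A i)) -> (forall i, (P (A i) <= r%:E)%E) ->
  (P (\big[setU/set0]_(i : I) A i) <= (#|I|%:R * r)%:E)%E.
Proof.
move=> mA PA.
suff H s : (P (\big[setU/set0]_(i <- s) A i) <= ((size s)%:R * r)%:E)%E.
  have := H (index_enum I); rewrite -sum1_size (eq_bigl (fun i => i \in I))//.
  by rewrite sum1_card.
rewrite mulr_natl; elim: s => [|i s IH]; first by rewrite big_nil measure0 mulr0n.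
rewrite big_cons /= mulrS EFinD.
apply: le_trans (measureU2 _ (mA i) _) _; first exact: bigsetU_measurable.
by apply: leeD; [exact: PA | exact: IH].
Qed.

(** The limit superior is an infimum over neighbourhoods of infinity, and the set where the bound
    holds is one of them. *)
Lemma limn_esup_le_near {R : realType} (u : nat -> \bar R) (l : \bar R) :
  (\forall n \near \oo, (u n <= l)%E) -> (limn_esup u <= l)%E.
Proof.
move=> H; apply: le_trans (_ : ereal_sup (u @` [set n | (u n <= l)%E]) <= l)%E.
  by apply: ereal_inf_lbound; exists [set n | (u n <= l)%E].
by apply: ge_ereal_sup => _ [n /= unl <-].
Qed.

(** Brings the union bound [2 n^-4] below the Borel-Cantelli term. *)
Lemma mul_succ_le_exp4 n : (3 <= n)%N -> (n.+1 * n.+2 * 2 <= n ^ 4)%N.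
Proof.
move=> n3; rewrite (_ : (n ^ 4 = (n * n) * (n * n))%N); last by rewrite !expnS expn0 muln1 !mulnA.
have n9 : (3 * 3 <= n * n)%N by exact: leq_mul.
have n3n : (3 * n <= n * n)%N by exact: leq_mul.
apply: leq_trans (leq_mul n9 (leqnn (n * n)%N)); lia.
Qed.

Theorem theorem1 (R : realType) (dT : measure_display) (T : measurableType dT)
  (P : probability T R) (d : nat) (eps : Zd d -> T -> R)
  (g : Rd R d -> R) (K : Rd R d -> R) (h : nat -> R) :
  (1 <= d)%N ->
  (forall i, measurable_fun setT (eps i)) ->
  strictly_stationary P eps ->
  ('E_P[eps (zzero d)] = 0)%E ->
  (forall n, 0 < h n) ->
  h @ \oo --> 0 ->
  (fun n => n%:R * h n) @ \oo --> +oo ->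
  A1 K -> C1 P eps ->
  exists lam : R, 0 < lam /\
    {ae P, forall w,
      (limn_esup (fun n =>
         ereal_sup [set `| (g_est g eps K h n x w)%:E - 'E_P[g_est g eps K h n x] |%E
                   | x in @unit_cube R d]
         * ((Num.sqrt (ln n%:R) / (Num.sqrt (n%:R * h n)) ^+ d)^-1)%:E)
       <= lam%:E)%E}.
Proof.
move=> _ meps stat E0 h0 hcv nhcv [_ [_ [_ [K0 [[eta [eta0 Klip]] [c [C [c0 [C0 Kbnd]]]]]]]]].
move=> [epsLoo [Y [HY sumY]]].
have PT0 : (0 < P setT)%E by rewrite [X in (_ < X)%E](_ : _ = 1%E) ?lte01//; exact: probability_setT.
have [M [M0 eps0M]] : exists M : R, 0 <= M /\ {ae P, forall w, `|eps (zzero d) w| <= M}.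
  have [M HM] := @ess_supr_bounded _ _ _ P (fun w => `|eps (zzero d) w|) epsLoo.
  exists `|M|; split=> //; apply: filterS HM => w /= wM.
  exact: le_trans wM (ler_norm _).
pose q k := Linfty_norm P (fun w => eps k w * Y k w).
have q0 k : (0 <= q k)%E.
  by apply: (@ess_sup_ger _ _ _ P (fun w => `|eps k w * Y k w|)) => // t; rewrite lee_fin.
have sum_q s : uniq s -> (forall k, k \in s -> Vset (zzero d) 1 k) ->
    (\sum_(k <- s) q k <= \esum_(k in Vset (zzero d) 1) q k)%E.
  move=> us sV; apply: esum_ge; exists [set` s]; last by rewrite -fsbig_seq.
  by split; [exact: finite_seq | move=> k /sV].
have q_fin k : Vset (zzero d) 1 k -> q k \is a fin_num.
  move=> Vk; rewrite ge0_fin_numE//; apply: le_lt_trans sumY.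
  have := sum_q [:: k]; rewrite big_seq1; apply => // j.
  by rewrite inE => /eqP ->.
(* Finiteness of the sum in (C1) makes [q k] finite for [k] in the past, the only sites where [b k]
   has to be a bound. *)
pose b k := fine (q k).
have b0 k : 0 <= b k by rewrite fine_ge0.
have Hb k : Vset (zzero d) 1 k -> {ae P, forall w, `|eps k w * Y k w| <= b k}.
  move=> Vk; have := ess_sup_ge P (fun w => (`|eps k w * Y k w|)%:E).
  apply: filterS => w; rewrite -/(Linfty_norm _ _) -/(q k) => wq.
  by rewrite -lee_fin fineK// q_fin.
pose B := fine (\esum_(k in Vset (zzero d) 1) q k)%E.
have HB s : uniq s -> (forall k, k \in s -> Vset (zzero d) 1 k) -> \sum_(k <- s) b k <= B.
  move=> us sV; rewrite -lee_fin /B fineK.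
    rewrite -sumEFin [leLHS](_ : _ = \sum_(k <- s) q k)%E; first exact: sum_q.
    rewrite big_seq [RHS]big_seq; apply: eq_bigr => k ks.
    by rewrite /b fineK// q_fin//; exact: sV.
  rewrite ge0_fin_numE//.
  by apply: le_trans (sum_q [::] isT _); rewrite ?big_nil.
pose V := 2 * M ^+ 2 + 2 * B.
have B0 : 0 <= B by have := HB [::] isT; rewrite big_nil; exact.
have V0 : 0 <= V by rewrite /V; nra.
have HE a s t : 0 <= t -> (forall j, `|a j| <= t) -> uniq s ->
    \int[P]_w expR (lin_comb eps M a s w) <= expR (V * t ^+ 2 * (size s)%:R).
  exact: (Rintegral_exp_lin_le meps stat M0 eps0M E0 HY b0 Hb HB).
(* The lattice is countable, so one null set serves all sites; indices that decode to no site carry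
   a trivial condition. *)
have ae_eps : {ae P, forall w k, `|eps k w| <= M}.
  have H (i : nat) : {ae P, forall w, (if unpickle i is Some k then `|eps k w| <= M else true)}.
    case: (unpickle i : option (Zd d)) => [k|]; last exact: aeW.
    exact: (ae_norm_stationary_le meps stat eps0M).
  apply: filterS (ae_foralln H) => w Hw k.
  by have := Hw (pickle k); rewrite pickleK.
have ieps k : P.-integrable setT (EFin \o eps k).
  exact: ae_bounded_integrable (ae_norm_stationary_le meps stat eps0M k).
(* On the empty list of sites the exponential is 1, and the shift identity becomes equality of
   means. *)
have Ieps k : \int[P]_w eps k w = 0.
  rewrite -(Rintegral_clipped0 meps stat M0 eps0M E0).
  have := Rintegral_clipped_expR_shift meps stat (fun _ => 0) k [::] M0.
  rewrite /= /lin_comb.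
  under eq_Rintegral do rewrite big_nil expR0 mulr1.
  under [in X in _ = X -> _]eq_Rintegral do rewrite big_nil expR0 mulr1.
  move=> <-; apply: ae_eq_Rintegral => //.
    by case: (bounded_mfun_clipped meps k M0).
  by apply: filterS ae_eps => w Hw; rewrite /clipped clip_id.
(* There are at most [n^e] cells for [n >= 3], and [lam] makes the exponent [V C^2 - lam] equal to
   [-(e + 4)]. *)
pose e := ((d + 6) * d)%N.
pose lam := V * C ^+ 2 + (e + 4)%:R.
have lam0 : 0 <= lam by rewrite /lam addr_ge0// mulr_ge0// sqr_ge0.
pose code n := (d.-tuple ('I_(2 * n).+1 * 'I_(2 * n).+1 * 'I_(n ^ d.+1).+1))%type.
(* A point of the cell, or the origin for a code that no point of the cube has; the probability
   bound below holds in either case. *)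
pose rep n (z : code n) : Rd R d :=
  xget [tuple 0 | l < d] [set x | unit_cube x /\ cell n (n ^ d.+1) (h n) x = z].
pose dev n (z : code n) w := lin_comb eps M (fun k => K (scaled n (h n) (rep n z) k))
  (active_sites n (h n) (rep n z)) w.
pose bad n (z : code n) := [set w | lam * Num.sqrt (ln n%:R *
  (size (active_sites n (h n) (rep n z)))%:R) < `|dev n z w| ].
have mbad n z : measurable (bad n z).
  have md : measurable_fun setT (fun w => `|dev n z w|).
    apply: measurableT_comp => //.
    exact: (proj1 (bounded_mfun_lin_comb meps _ _ M0)).
  rewrite /bad; set r := lam * _.
  have := md measurableT `]r, +oo[%classic (measurable_itv _).
  by rewrite setTI; congr measurable; apply/seteqP; split => w /=; rewrite in_itv/= andbT.
(* The threshold [3] makes [n^e] cells of probability [2 n^-(e+4)] summable term by term. *)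
pose F n := if (n < 3)%N then set0 else \big[setU/set0]_(z : code n) bad n z.
have mF n : measurable (F n).
  by rewrite /F; case: ifP => // _; exact: bigsetU_measurable.
have PF n : (P (F n) <= ((n.+1 * n.+2)%:R^-1)%:E)%E.
  rewrite /F; case: ltnP => n3; first by rewrite measure0 lee_fin invr_ge0.
  have n1 : 1 <= n%:R :> R by rewrite ler1n; exact: ltnW (ltnW n3).
  have n0 : 0 < n%:R :> R by lra.
  have L0 : 0 <= ln n%:R :> R by exact: ln_ge0.
  pose r : R := 2 * (n%:R ^+ (e + 4))^-1.
  have Pbad z : (P (bad n z) <= r%:E)%E.
    (* Without active sites both sides vanish and the strict inequality fails. *)
    have [s0|s0] := posnP (size (active_sites n (h n) (rep n z))).
      rewrite (_ : bad n z = set0) ?measure0 ?lee_fin ?mulr_ge0 ?invr_ge0 ?exprn_ge0//.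
      apply/seteqP; split => w //=; rewrite /bad /dev /lin_comb /= s0.
      by rewrite (size0nil s0) big_nil mulr0 sqrtr0 mulr0 normr0 ltxx.
    have := @probability_lin_comb_le _ _ _ P d eps M V
      (fun k => K (scaled n (h n) (rep n z) k)) _ C (ln n%:R) lam meps M0 HE L0 (ltW C0)
      (fun k => norm_kernel_le c0 C0 K0 Kbnd _) (active_sites_uniq _ _ _) s0.
    move=> /le_trans; apply; rewrite lee_fin ler_wpM2l//.
    rewrite (_ : _ * _ = - ((e + 4)%:R * ln n%:R)); last by rewrite /lam; ring.
    by rewrite expRN expRM_natl lnK ?posrE.
  apply: le_trans (probability_bigsetU_le (mbad n) Pbad) _.
  rewrite lee_fin; apply: (@le_trans _ _ ((n ^ e)%:R * r)).
    rewrite ler_wpM2r ?mulr_ge0 ?invr_ge0 ?exprn_ge0// ler_nat.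
    exact: card_cell_le.
  rewrite /r natrX exprD invfM mulrCA [X in 2 * X]mulrA mulfV ?mul1r ?expf_neq0 ?gt_eqF//.
  rewrite ler_pdivrMr ?exprn_gt0// ler_pdivlMl ?ltr0n// -natrX -natrM ler_nat.
  exact: mul_succ_le_exp4.
(* [lam'] is the constant of the rate comparison with [A = M eta]; the summand [1] gives strict
   positivity at once. *)
exists (lam * 2 ^+ d / c + M * eta / c + 1); set lam' := _ + M * eta / c.
have lam'0 : 0 <= lam'.
  by rewrite addr_ge0// divr_ge0 ?mulr_ge0 ?exprn_ge0 ?(ltW c0) ?(ltW eta0).
split; first by rewrite ltr_wpDl.
apply: filterS2 ae_eps (lim_sup_set_null mF PF) => w epsM [n0 Fn0].
apply: limn_esup_le_near.
have h2 : \forall n \near \oo, h n <= 2^-1 by apply: cvgr_le hcv _ _; rewrite invr_gt0.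
have nh1 : \forall n \near \oo, 1 <= n%:R * h n by move/cvgryPge: nhcv; exact.
near=> n.
have hn : 0 < h n <= 2^-1 by rewrite h0 /=; near: n.
have nhn : 1 <= n%:R * h n by near: n.
have n3 : (3 <= n)%N by near: n; exact: nbhs_infty_ge.
have n00 : (n0 <= n)%N by near: n; exact: nbhs_infty_ge.
(* From here on the logarithm is at least 1, so the rate is positive and dominates the
   discretisation error. *)
have n_e : expR 1 <= n%:R :> R by near: n; exact: nbhs_infty_ger.
have L1 : 1 <= ln n%:R :> R.
  by rewrite -[leLHS]expRK ler_ln// posrE ?expR_gt0// ltr0n (ltnW (ltnW n3)).
set v := Num.sqrt _ / _.
have v0 : 0 < v.
  by rewrite divr_gt0 ?exprn_gt0 ?sqrtr_gt0//; lra.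
apply: (@le_trans _ _ ((lam' * v)%:E * (v^-1)%:E)%E); last first.
  by rewrite -EFinM mulfK ?gt_eqF// lee_fin lerDl.
apply: lee_wpmul2r; first by rewrite lee_fin invr_ge0 ltW.
apply: ge_ereal_sup => _ [x cx <-].
rewrite g_est_centered// abse_EFin lee_fin.
(* This code is attained by [x], so its representative is a genuine point of the same cell. *)
pose z : code n := cell n (n ^ d.+1) (h n) x.
have [cy yz] : unit_cube (rep n z) /\ cell n (n ^ d.+1) (h n) (rep n z) = z.
  exact: (@xgetPex _ [tuple 0 | l < d]
    [set x | unit_cube x /\ cell n (n ^ d.+1) (h n) x = z] (ex_intro _ x (conj cx erefl))).
have n_gt0 : (0 < n)%N by exact: ltnW (ltnW n3).
have m_gt0 : (0 < n ^ d.+1)%N by rewrite expn_gt0 n_gt0.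
have h01 : 0 <= h n <= 1 by case/andP: hn => ? ?; apply/andP; split; lra.
have [actE distE] := cell_eqP n_gt0 m_gt0 h01 cx cy (esym yz).
set N := size (active_sites n (h n) (rep n z)).
have kN : (Num.truncn (n%:R * h n) ^ d <= N)%N.
  by rewrite /N size_active_sites; exact: card_active_ge.
have N0 : (0 < N)%N.
  by apply: leq_trans kN; rewrite expn_gt0 truncn_gt0 nhn.
have r0 : 0 <= (n ^ d.+1)%:R^-1 :> R by rewrite invr_ge0.
apply: le_trans (kernel_ratio_le c0 eta0 K0 Klip Kbnd (h0 n) r0 M0 actE distE epsM N0) _.
apply: le_trans (noise_rate_le n_gt0 hn nhn L1 c0 lam0 (mulr_ge0 M0 (ltW eta0)) kN).
rewrite lerD2r ler_wpM2r ?invr_ge0 ?mulr_ge0 ?(ltW c0)// leNgt.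
(* Exceeding the threshold at the representative would put [w] in [F n]; clipping changes nothing,
   as [w] satisfies the bound by [M] at every site. *)
apply/negP => wbad; apply: (Fn0 n n00).
rewrite /F ltnNge n3 /= -bigcup_seq; exists z; first exact: mem_index_enum.
rewrite /bad /= /dev /lin_comb.
by under [X in `|X|]eq_bigr do rewrite /clipped clip_id//.
Unshelve. all: by end_near.
Qed.
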